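(* For every oriented matroid $\mathsf M$ on a ground set $E$ and every $e\in E$, there is a homotopy equivalence $|\mathcal S|\simeq S^1\times|d\mathcal S|$, where $\mathcal S$ is the Salvetti poset of $\mathsf M$ and $d\mathcal S$ its deconed Salvetti poset with respect to $e$.
   Context: Covectors $\mathcal F\subseteq\{+,0,-\}^E$ of $\mathsf M$ are ordered componentwise with $0<+$, $0<-$; topes $\mathcal T$ are the maximal covectors. Composition: $(X\circ Y)_f=Y_f$ if $X_f=0$, else $X_f$. The Salvetti poset is $\mathcal S=\{(F,C)\in\mathcal F\times\mathcal T: F\circ C=C\}$ with $(F,C)\le(F',C')$ iff $F\ge F'$ and $F\circ C'=C$. Let $d\mathcal F=\{F\in\mathcal F: F_e=+\}$ and $d\mathcal S=\{(F,C)\in\mathcal S: F,C\in d\mathcal F\}$ with the induced order. $|\mathcal P|$ denotes the geometric realization of the order complex of a poset $\mathcal P$.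
   Formalization: The formal theorem additionally assumes that e is not a loop (some covector is nonzero at e); if e is a loop, the deconed Salvetti poset is empty while the Salvetti poset is not, so the claim fails. *)

(* Defs.v *)
From HB Require Import structures.
From mathcomp Require Import all_boot all_order all_algebra.
From mathcomp Require Import all_classical all_reals all_analysis.

Set Implicit Arguments.
Unset Strict Implicit.
Unset Printing Implicit Defensive.

Import Order.TTheory GRing.Theory Num.Theory.
Import numFieldNormedType.Exports.
Local Open Scope ring_scope.
Local Open Scope classical_set_scope.

Definition sign := option bool.
Definition s0 : sign := None.
Definition splus : sign := Some true.
Definition sminus : sign := Some false.
Definition sneg (s : sign) : sign := omap negb s.
Definition sign_le (a b : sign) : bool := (a == s0) || (a == b).

Definition signvec (E : finType) := {ffun E -> sign}.

Definition sv_zero (E : finType) : signvec E := [ffun _ => s0].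
Definition sv_neg (E : finType) (X : signvec E) : signvec E :=
  [ffun f => sneg (X f)].
Definition compose (E : finType) (X Y : signvec E) : signvec E :=
  [ffun f => if X f == s0 then Y f else X f].
Definition sv_le (E : finType) (X Y : signvec E) : bool :=
  [forall f, sign_le (X f) (Y f)].
Definition sep (E : finType) (X Y : signvec E) (f : E) : bool :=
  (X f != s0) && (Y f == sneg (X f)).

(** * Oriented matroids, via the covector axioms (Bjoerner et al., Def. 4.1.1) *)
Definition is_OM_covectors (E : finType) (L : {set signvec E}) : Prop :=
  [/\ sv_zero E \in L,
      (forall X, X \in L -> sv_neg X \in L),
      (forall X Y, X \in L -> Y \in L -> compose X Y \in L) &
      (forall X Y e, X \in L -> Y \in L -> sep X Y e ->
         exists2 Z, Z \in L &
           Z e = s0 /\ (forall f, ~~ sep X Y f -> Z f = compose X Y f))].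

Definition topes (E : finType) (L : {set signvec E}) : {set signvec E} :=
  [set T in L | [forall X in L, sv_le T X ==> (X == T)]].

Definition salvetti (E : finType) (L : {set signvec E})
  : {set (signvec E * signvec E)} :=
  [set p | [&& p.1 \in L, p.2 \in topes L & compose p.1 p.2 == p.2]].

Definition salv_le (E : finType) : rel (signvec E * signvec E) :=
  fun p q => sv_le q.1 p.1 && (compose p.1 q.2 == p.2).

Definition dcov (E : finType) (L : {set signvec E}) (e : E) : {set signvec E} :=
  [set F in L | F e == splus].

Definition dsalvetti (E : finType) (L : {set signvec E}) (e : E)
  : {set (signvec E * signvec E)} :=
  [set p in salvetti L | (p.1 \in dcov L e) && (p.2 \in dcov L e)].

Definition realization_set (R : realType) (P : finType) (A : {set P})
  (le : rel P) : set {ptws P -> R} :=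
  [set t | [/\ (forall x, 0 <= t x),
              (forall x, x \notin A -> t x = 0),
              \sum_(x : P) t x = 1 &
              (forall x y, 0 < t x -> 0 < t y -> le x y || le y x)]].

Arguments realization_set R {P} A le.

Definition circle (R : realType) : set (R * R)%type :=
  [set z | z.1 ^+ 2 + z.2 ^+ 2 = 1].

Arguments circle R : clear implicits.

Definition homotopic (R : realType) (X Y : topologicalType) (f g : X -> Y) : Prop :=
  exists H : (R * X)%type -> Y,
    [/\ {within `[0, 1] `*` [set: X], continuous H},
        (forall x, H (0, x) = f x) &
        (forall x, H (1, x) = g x)].

Definition homotopy_equivalent (R : realType) (X Y : topologicalType) : Prop :=
  exists (f : X -> Y) (g : Y -> X),
    [/\ continuous f, continuous g,
        homotopic R (g \o f) id & homotopic R (f \o g) id].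

(* Main.v *)
(* For a hyperplane arrangement, z |-> (z_e / |z_e|, z / z_e) trivializes the
   complement over the circle. Combinatorially, the complement is modelled by the
   poset N of pairs of covectors (real and imaginary part) without common zeros;
   Quillen's fibre lemma identifies it with the Salvetti poset, and the subposet
   N+ of pairs with e-entry (+, 0) with the deconed Salvetti poset. Division by
   z_e is a relation between N and N+: the circle is cut into four rays and four
   open quadrants, on a ray division is an exact rotation by a multiple of a right
   angle, and on a quadrant it relates a cell to all cells met while it turns by a
   right angle. The poset of all triples (arc, cell of N over the closed arc, cell
   of N+) in this relation projects onto N and onto arcs x N+, and all fibres
   contract because a nonempty set of sign vectors closed under composition and
   elimination has a contractible realization. *)

Require Import Defs.
From HB Require Import structures.
From mathcomp Require Import all_boot all_order all_algebra.
From mathcomp Require Import all_classical all_reals all_analysis.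
From mathcomp Require Import ring lra.
Set Implicit Arguments.
Unset Strict Implicit.
Unset Printing Implicit Defensive.
Import Order.TTheory GRing.Theory Num.Theory.
Import numFieldNormedType.Exports.
Local Open Scope ring_scope.
Local Open Scope classical_set_scope.

(** * Continuity on subsets *)

(** Division by z_e is only a relation between cells, because the signs of x and y do not determine
    the sign of x cos t + y sin t. The relation [swept] is monotone, however: it grows with the arc
    and with the source cell, and shrinks as the target cell grows. Hence the triples carry the
    reversed order on their last component, and each fibre of the two projections reduces to the
    cells related to one fixed pair. Over a quadrant these reduced fibres need not be closed under
    elimination, since [sector] is a union of two conditions. For a fixed source, the targets are
    moved into a convex part of the swept region. For a fixed target, the real parts of the sources
    are chosen before the imaginary parts, so that each stage imposes one sign condition per
    element. The fibre lemma is obtained by extending maps simplex by simplex inside contractible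
    carriers, which produces the homotopy inverse and both homotopies directly. *)

Section Within.
Context {X Y Z : topologicalType}.

Lemma within_eq (A : set X) (f g : X -> Y) :
  (forall x, A x -> f x = g x) ->
  {within A, continuous f} -> {within A, continuous g}.
Proof.
by move=> fg; apply: subspace_eq_continuous => x; rewrite inE; exact: fg.
Qed.

Lemma within_comp (A : set X) (B : set Y) (f : X -> Y) (g : Y -> Z) :
  (forall x, A x -> B (f x)) ->
  {within A, continuous f} -> {within B, continuous g} ->
  {within A, continuous (fun x => g (f x))}.
Proof.
move=> fAB /subspace_continuousP cf /subspace_continuousP cg.
apply/subspace_continuousP => x Ax.
apply: cvg_trans (cg _ (fAB _ Ax)) => W gW.
have : nbhs x (fun y => A y -> B (f y) -> W (g (f y))) by exact: cf _ Ax _ gW.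
move=> cfW; have : nbhs x (fun y => A y -> W (g (f y))).
  by apply: filterS cfW => y fW Ay; exact: fW Ay (fAB _ Ay).
exact.
Qed.

Lemma within_pair (A : set X) (f : X -> Y) (g : X -> Z) :
  {within A, continuous f} -> {within A, continuous g} ->
  {within A, continuous (fun x => (f x, g x))}.
Proof. by move=> cf cg x; apply: cvg_pair; [exact: cf|exact: cg]. Qed.

End Within.

Lemma within_ptws (R : realType) (X : topologicalType) (T : finType) (A : set X)
    (f : X -> {ptws T -> R}) :
  (forall i, {within A, continuous (fun x => f x i)}) ->
  {within A, continuous f}.
Proof.
move=> cf x; apply/cvg_sup => i.
exact: (@continuous_comp_initial _ (subspace A) _ (@proj T (fun=> R) i) f (cf i) x).
Qed.

Lemma ptws_coord_continuous (R : realType) (T : finType) (i : T) :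
  continuous (fun t : {ptws T -> R} => t i).
Proof. exact: (@proj_continuous T (fun=> R) i). Qed.

Section RealOps.
Variables (R : realType) (X : topologicalType).
Implicit Types f g : X -> R.

Lemma contD f g : continuous f -> continuous g -> continuous (fun x => f x + g x).
Proof. by move=> cf cg x; apply: cvgD; [exact: cf|exact: cg]. Qed.

Lemma contB f g : continuous f -> continuous g -> continuous (fun x => f x - g x).
Proof. by move=> cf cg x; apply: cvgB; [exact: cf|exact: cg]. Qed.

Lemma contM f g : continuous f -> continuous g -> continuous (fun x => f x * g x).
Proof. by move=> cf cg x; apply: cvgM; [exact: cf|exact: cg]. Qed.

Lemma cont_cst (a : R) : continuous (fun _ : X => a).
Proof. by move=> x; exact: cvg_cst. Qed.

Lemma continuous_sum (I : finType) (P : pred I) (F : I -> X -> R) :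
  (forall i, continuous (F i)) -> continuous (fun x => \sum_(i | P i) F i x).
Proof. by move=> cF; apply: continuous_big => //; exact: add_continuous. Qed.

Variable A : set X.

Lemma withinV f : (forall x, A x -> f x != 0) -> {within A, continuous f} ->
  {within A, continuous (fun x => (f x)^-1)}.
Proof.
move=> f0 /subspace_continuousP cf; apply/subspace_continuousP => x Ax.
by apply: cvgV; [exact: f0|exact: cf].
Qed.

End RealOps.

(** * Contractible sets and the extension of maps into them *)

Section Contractible.
Variable R : realType.

Definition unit_itv : set R := [set s | 0 <= s <= 1].

Definition contracts (Y : topologicalType) (C : set Y) (c : Y) (h : R * Y -> Y) :=
  [/\ C c, {within unit_itv `*` C, continuous h},
      forall s y, 0 <= s <= 1 -> C y -> C (h (s, y)),
      forall y, C y -> h (0, y) = y &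
      forall y, C y -> h (1, y) = c].

Definition contractible (Y : topologicalType) (C : set Y) :=
  exists c h, contracts C c h.

Lemma closed_le_preimage (X : topologicalType) (s : X -> R) (a : R) :
  continuous s -> closed [set x | s x <= a].
Proof.
move=> cs; apply: (@closed_comp _ _ s [set y | y <= a]); last exact: closed_le.
by move=> x _; exact: cs.
Qed.

Lemma closed_ge_preimage (X : topologicalType) (s : X -> R) (a : R) :
  continuous s -> closed [set x | a <= s x].
Proof.
move=> cs; apply: (@closed_comp _ _ s [set y | a <= y]); last exact: closed_ge.
by move=> x _; exact: cs.
Qed.

(** [s] measures the depth in the new piece [D], and [u] pushes shallow points back to where [f] is
    defined. The collar up to depth 1/2 carries the contraction of the boundary values, and the core
    is sent to its end point [c]. Asking for [u] on the collar only is what lets it be a radial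
    projection, which breaks down at the centre. *)
Lemma extend_step (X Y : topologicalType) (A D : set X) (s : X -> R) (u : X -> X)
    (C : set Y) (f : X -> Y) :
  closed A -> closed D -> continuous s ->
  {within D `&` [set x | s x <= 2^-1], continuous u} ->
  (forall x, D x -> 0 <= s x) ->
  (forall x, D x -> s x <= 2^-1 -> A (u x) /\ D (u x)) ->
  (forall x, A x -> D x -> s x = 0 /\ u x = x) ->
  {within A, continuous f} -> (forall x, A x -> D x -> C (f x)) ->
  contractible C ->
  exists g : X -> Y, [/\ {within A `|` D, continuous g},
    forall x, A x -> g x = f x & forall x, D x -> C (g x)].
Proof.
move=> cA cD cs cu s0 uAD sAD cf fC [c [h [Cc ch hC h0 h1]]].
pose g x := if `[< A x >] then f x else if s x <= 2^-1 then h (2 * s x, f (u x)) else c.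
have gA x : A x -> g x = f x by move=> Ax; rewrite /g asboolT.
have g1 x : D x -> s x <= 2^-1 -> h (2 * s x, f (u x)) = g x.
  move=> Dx sx; rewrite /g; case: asboolP => [Ax|_]; last by rewrite sx.
  by have [-> ->] := sAD _ Ax Dx; rewrite mulr0 h0//; exact: fC.
have g2 x : D x -> 2^-1 <= s x -> c = g x.
  move=> Dx sx; rewrite /g; case: asboolP => [Ax|_].
    have [sx0 _] := sAD _ Ax Dx.
    by move: sx; rewrite sx0 invr_le0 lern0.
  case: ifPn => // sx'.
  have -> : s x = 2^-1 by apply/le_anti/andP.
  by rewrite mulfV// h1//; have [? ?] := uAD _ Dx sx'; exact: fC.
exists g; split => //; last first.
  move=> x Dx; case: (leP (s x) 2^-1) => sx; last first.
    by rewrite -(g2 _ Dx)// ltW.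
  rewrite -g1//; have [Au Du] := uAD _ Dx sx; apply: hC; last exact: fC.
  by have := s0 _ Dx; lra.
have -> : A `|` D = A `|` ((D `&` [set x | s x <= 2^-1]) `|` (D `&` [set x | 2^-1 <= s x])).
  apply/seteqP; split => x /=; last by case=> [|[[]|[]]]; auto.
  case; first by left.
  by move=> Dx; right; case: (leP (s x) 2^-1) => [|/ltW]; auto.
have c1 : closed (D `&` [set x | s x <= 2^-1]).
  by apply: closedI => //; exact: closed_le_preimage.
have c2 : closed (D `&` [set x | 2^-1 <= s x]).
  by apply: closedI => //; exact: closed_ge_preimage.
apply: withinU_continuous => //; first exact: closedU.
  by apply: within_eq cf => x Ax; rewrite gA.
apply: withinU_continuous => //.
  apply: (@within_eq _ _ _ (fun x => h (2 * s x, f (u x)))).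
    by move=> x [Dx sx]; exact: g1.
  apply: (@within_comp _ _ _ _ (unit_itv `*` C) (fun x => (2 * s x, f (u x))) h) => //.
    move=> x [Dx sx]; split => /=; last first.
      by have [? ?] := uAD _ Dx sx; exact: fC.
    by rewrite /unit_itv /=; have := s0 _ Dx; move: sx => /= ; lra.
  apply: within_pair.
    apply: continuous_subspaceT => x.
    by apply: cvgM; [exact: cvg_cst | exact: cs].
  apply: (@within_comp _ _ _ _ A u f) => //.
  by move=> x [Dx sx]; have [] := uAD _ Dx sx.
apply: (@within_eq _ _ _ (fun=> c)); first by move=> x [Dx sx]; exact: g2.
exact/continuous_subspaceT/cst_continuous.
Qed.

End Contractible.

Arguments unit_itv R : clear implicits.

(** * Carriers *)

Section Simplices.
Variables (R : realType) (T : finType).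
Local Notation space := {ptws T -> R}.

Definition simplex (s : {set T}) : set space :=
  [set t | [/\ forall x, 0 <= t x, forall x, x \notin s -> t x = 0
             & \sum_x t x = 1]].

Lemma closed_simplex s : closed (simplex s).
Proof.
have -> : simplex s = (\bigcap_(x in [set: T]) [set t : space | 0 <= t x]) `&`
   ((\bigcap_(x in [set x | x \notin s]) [set t : space | t x = 0]) `&` [set t : space |
     \sum_x t x = 1]).
  apply/seteqP; split => t /=.
    by move=> [t0 ts t1]; split => [x _|]; [exact: t0|split => // x /=; exact: ts].
  by move=> [t0 [ts t1]]; split => [x|x xs|]; [exact: t0|exact: ts|].
apply: closedI; last apply: closedI.
- apply: closed_bigI => x _.
  by apply: closed_ge_preimage; exact: ptws_coord_continuous.
- apply: closed_bigI => x _.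
  apply: (@closed_comp _ _ (fun t : space => t x) [set 0]); last exact: closed_eq.
  by move=> t _; exact: ptws_coord_continuous.
- apply: (@closed_comp _ _ (fun t : space => \sum_x t x) [set 1]); last exact: closed_eq.
  move=> t _; apply: continuous_sum => i; exact: ptws_coord_continuous.
Qed.

Lemma simplexI (s s' : {set T}) t : simplex s t -> simplex s' t -> simplex (s :&: s') t.
Proof.
move=> [t0 ts t1] [_ ts' _]; split => // x; rewrite finset.in_setI negb_and.
by case/orP; [exact: ts|exact: ts'].
Qed.

Lemma simplex_neq0 (s : {set T}) t : simplex s t -> s != finset.set0.
Proof.
move=> [_ ts /eqP]; apply: contraTneq => s0.
rewrite big1 ?(eq_sym 0) ?oner_eq0// => x _.
by apply: ts; rewrite s0 finset.in_set0.
Qed.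

(* [gauge] vanishes on the boundary of the prism [simplex s * [0, 1]] and is [1]
   at its centre; [push] is the radial projection away from the centre. *)
Definition gauge (s : {set T}) (z : space * R) : R :=
  Num.min (Num.min (2 * z.2) (2 * (1 - z.2)))
    (\big[Num.min/1]_(x in s) (#|s|%:R * z.1 x)).

Definition push (s : {set T}) (z : space * R) : space * R :=
  (fun x => (z.1 x - gauge s z * ((x \in s)%:R / #|s|%:R)) / (1 - gauge s z),
   (z.2 - gauge s z / 2) / (1 - gauge s z)).

Lemma continuous_fst_coord x : continuous (fun z : space * R => z.1 x).
Proof.
move=> z; apply: (@continuous_comp _ _ _ fst (fun t : space => t x)); first exact: cvg_fst.
exact: ptws_coord_continuous.
Qed.

Lemma continuous_snd : continuous (fun z : space * R => z.2).
Proof. by move=> z; exact: cvg_snd. Qed.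

Lemma continuous_gauge s : continuous (gauge s).
Proof.
apply: min_fun_continuous.
  apply: min_fun_continuous; apply: contM.
  - exact: cont_cst.
  - exact: continuous_snd.
  - exact: cont_cst.
  - by apply: contB; [exact: cont_cst|exact: continuous_snd].
apply: continuous_big; first exact: min_continuous.
by move=> x _; apply: contM; [exact: cont_cst|exact: continuous_fst_coord].
Qed.

Lemma gauge_le_l s z : gauge s z <= 2 * z.2.
Proof. by rewrite /gauge !ge_min lexx. Qed.

Lemma gauge_le_r s z : gauge s z <= 2 * (1 - z.2).
Proof. by rewrite /gauge !ge_min lexx orbT. Qed.

Lemma gauge_le_coord (s : {set T}) z x : x \in s -> gauge s z <= #|s|%:R * z.1 x.
Proof. by move=> xs; rewrite /gauge ge_min bigmin_le_cond ?orbT. Qed.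

Lemma gauge_ge0 s z : simplex s z.1 -> 0 <= z.2 <= 1 -> 0 <= gauge s z.
Proof.
move=> [t0 _ _] /andP[a0 a1]; rewrite /gauge !le_min !mulr_ge0 ?subr_ge0//=.
apply/bigmin_geP; split => // x _; exact: mulr_ge0.
Qed.

(** A value of at most 1/2 excludes the initial value 1 of the minimum. The term that attains it
    names the face of the prism on which [push] lands. *)
Lemma gauge_attained s z : gauge s z <= 2^-1 ->
  [\/ gauge s z = 2 * z.2, gauge s z = 2 * (1 - z.2) |
      exists2 x, x \in s & gauge s z = #|s|%:R * z.1 x].
Proof.
rewrite /gauge; set m := \big[_/_]_(_ in _) _.
have : m = 1 \/ exists2 x, x \in s & m = #|s|%:R * z.1 x.
  rewrite /m; elim/big_rec: _ => [|x y xs IH]; first by left.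
  rewrite /Order.min; case: ifP => _ //; by right; exists x.
case: (leP (Num.min (2 * z.2) (2 * (1 - z.2))) m) => hm.
  by rewrite /Order.min; case: ifP => _; [constructor 1|constructor 2].
by case=> [->|[x xs mx]] h; [lra|constructor 3; exists x].
Qed.

Lemma push_simplex s z : simplex s z.1 -> 0 <= z.2 <= 1 -> gauge s z <= 2^-1 ->
  simplex s (push s z).1.
Proof.
move=> sz az g2; have [t0 ts t1] := sz.
have g0 := gauge_ge0 sz az.
have c0 : (#|s|%:R : R) != 0.
  by rewrite pnatr_eq0 cards_eq0; exact: simplex_neq0 sz.
have d0 : 1 - gauge s z != 0 by rewrite subr_eq0; apply/eqP; lra.
split => /= [x|x xs|].
- rewrite mulr_ge0 ?invr_ge0//; last by lra.
  rewrite subr_ge0; case: (boolP (x \in s)) => xs; last by rewrite mul0r mulr0.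
  rewrite div1r ler_pdivrMr ?ltr0n; last by rewrite lt0n -(eqr_nat R).
  by rewrite mulrC; exact: gauge_le_coord.
- by rewrite (negbTE xs) ts// mul0r mulr0 subrr mul0r.
- rewrite -mulr_suml sumrB t1 -mulr_sumr -mulr_suml.
  have -> : \sum_x ((x \in s)%:R : R) = #|s|%:R.
    by rewrite -natr_sum -big_mkcond sum1_card.
  by rewrite divff// mulr1 divff.
Qed.

Lemma within_push s (A : set (space * R)) :
  (forall z, A z -> gauge s z <= 2^-1) -> {within A, continuous (push s)}.
Proof.
move=> Ag.
have cg : {within A, continuous (gauge s)} by apply: continuous_subspaceT;
  exact: continuous_gauge.
have cd : {within A, continuous (fun z => (1 - gauge s z)^-1)}.
  apply: withinV; last by apply: contB; [exact: cont_cst|exact: cg].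
  by move=> z Az; have := Ag _ Az; rewrite subr_eq0 => h; apply/eqP; lra.
apply: within_pair.
  apply: within_ptws => x; apply: contM; last exact: cd.
  apply: contB; first by apply: continuous_subspaceT; exact: continuous_fst_coord.
  by apply: contM; [exact: cg|exact: cont_cst].
apply: contM; last exact: cd.
apply: contB; first by apply: continuous_subspaceT; exact: continuous_snd.
by apply: contM; [exact: cg|exact: cont_cst].
Qed.

End Simplices.

Section Carrier.
Variables (R : realType) (T : finType) (Y : topologicalType).
Local Notation space := {ptws T -> R}.

Definition body (K : seq {set T}) : set space :=
  [set t | exists2 s, s \in K & simplex s t].

Lemma closed_body K : closed (body K).
Proof.
elim: K => [|s K IH].
  have -> : body [::] = set0 by apply/seteqP; split => // t [].
  exact: closed0.
have -> : body (s :: K) = simplex s `|` body K.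
  apply/seteqP; split => t.
    move=> [s']; rewrite inE => /orP[/eqP->|]; first by left.
    by right; exists s'.
  case=> [st|[s' s'K st]]; first by exists s => //; rewrite mem_head.
  by exists s' => //; rewrite inE s'K orbT.
by apply: closedU => //; exact: closed_simplex.
Qed.

(** An order in which simplices can be attached: the whole boundary of [s] is present before [s],
    and [s] meets each earlier simplex in a proper face. *)
Definition face_ordered (K : seq {set T}) := forall K1 s K2, K = K1 ++ s :: K2 ->
  (forall s' : {set T}, s' \proper s -> s' != finset.set0 -> s' \in K1) /\
  (forall s' : {set T}, s' \in K1 -> ~~ (s \subset s')).

(* Maps are extended prism by prism, filling each one with a contraction of its
   carrier. [J = {1/2}] gives the existence of a carried map, [J = [0, 1]] that
   two carried maps are homotopic. *)
Lemma carrier_extend (K : seq {set T}) (J : set R) (C : {set T} -> set Y)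
    (f : space * R -> Y) :
  face_ordered K -> closed J -> (forall a, J a -> 0 <= a <= 1) ->
  (forall a s, J a -> 0 <= s <= 2^-1 -> s <= 2 * a -> s <= 2 * (1 - a) ->
    J ((a - s / 2) / (1 - s))) ->
  (forall s : {set T}, s \in K -> contractible R (C s)) ->
  (forall s s' : {set T}, s' \in K -> s \in K -> s' \subset s -> C s' `<=` C s) ->
  let E := J `&` [set a | a = 0 \/ a = 1] in
  {within body K `*` E, continuous f} ->
  (forall (s : {set T}) t a, s \in K -> simplex s t -> E a -> C s (f (t, a))) ->
  exists g : space * R -> Y, [/\ {within body K `*` J, continuous g},
    forall t a, body K t -> E a -> g (t, a) = f (t, a) &
    forall (s : {set T}) t a, s \in K -> simplex s t -> J a -> C s (g (t, a))].
Proof.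
move=> Kface cJ J01 Jpush Kctr Cmono E cf fC.
have cE : closed E.
  apply: closedI => //.
  have -> : [set a : R | a = 0 \/ a = 1] = [set 0] `|` [set 1] by [].
  by apply: closedU; exact: closed_eq.
have cX (A : set space) (B : set R) : closed A -> closed B -> closed (A `*` B).
  by move=> cA cB; have -> : A `*` B = (fst @^-1` A) `&` (snd @^-1` B) by [];
    apply: closedI; apply: closed_comp => // z _; [exact: cvg_fst|exact: cvg_snd].
(* Induction on the prefix of prisms already filled; the ends [E] are given over all of [K] from the
   start. *)
suff H : forall K1 K2, K = K1 ++ K2 -> exists g : space * R -> Y,
    [/\ {within body K `*` E `|` body K1 `*` J, continuous g},
    forall t a, body K t -> E a -> g (t, a) = f (t, a) &
    forall (s : {set T}) t a, s \in K1 -> simplex s t -> J a -> C s (g (t, a))].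
  have [g [cg gf gC]] := H K [::] (esym (cats0 K)); exists g; split => //.
  by apply: continuous_subspaceW cg => z; right.
elim/last_ind => [K2 _|K1 s IH K2 defK].
  exists f; split => //; apply: continuous_subspaceW cf => z [//|[[s]]] //.
rewrite cat_rcons in defK.
have [g [cg gf gC]] := IH _ defK.
have [faces cofaces] := Kface _ _ _ defK.
have sK : s \in K by rewrite defK mem_cat mem_head orbT.
have K1K (s' : {set T}) : s' \in K1 -> s' \in K by move=> ?; rewrite defK mem_cat;
  apply/orP; left.
pose A := body K `*` E `|` body K1 `*` J.
pose D := simplex (R := R) s `*` J.
have J01' z : D z -> 0 <= z.2 <= 1 by case=> _ /J01.
have J01'' z : D z -> gauge s z <= 2^-1 -> 1 - gauge s z != 0.
  by move=> _ g2; rewrite subr_eq0; apply/eqP; lra.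
have := @extend_step R _ Y A D (gauge s) (push s) (C s) g _ _ _ _ _ _ _ cg _ (Kctr _ sK).
case.
- by apply: closedU; apply: cX => //; exact: closed_body.
- by apply: cX => //; exact: closed_simplex.
- exact: continuous_gauge.
- by apply: within_push => z [].
- by move=> z Dz; apply: gauge_ge0; [case: Dz|exact: J01'].
- move=> z Dz g2; have g0 : 0 <= gauge s z by apply: gauge_ge0; [case: Dz|exact: J01'].
  have Pz : simplex s (push s z).1 by apply: push_simplex => //; [case: Dz|exact: J01'].
  have PJ : J (push s z).2.
    apply: Jpush; [by case: Dz|by rewrite g0|exact: gauge_le_l|exact: gauge_le_r].
  split => //; case: (gauge_attained g2) => [gz|gz|[x xs gz]].
  + left; split; first by exists s.
    by split => //; left; rewrite /= gz (mulrC 2) mulfK// subrr mul0r.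
  + left; split; first by exists s.
    split => //; right => /=; apply: (@mulIf _ (1 - gauge s z)); first exact: J01''.
    by rewrite mulfVK ?J01''// mul1r gz; field.
  + right; split => //; have P' : simplex (s :\ x) (push s z).1.
      split; [by case: Pz| |by case: Pz] => y; rewrite !inE negb_and negbK.
      case/orP => [/eqP ->|]; last by case: Pz => _ + _; apply.
      rewrite /= xs gz div1r mulrAC mulfV ?mul1r ?subrr ?mul0r//.
      by rewrite pnatr_eq0 cards_eq0; apply: simplex_neq0 Pz.
    exists (s :\ x) => //; apply: faces; last exact: simplex_neq0 P'.
    exact: properD1.
(* Points of the prism where the map is already defined lie on its boundary; there the gauge
   vanishes and [push] is the identity. *)
- move=> z Az Dz; have g0 : 0 <= gauge s z by apply: gauge_ge0; [case: Dz|exact: J01'].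
  suff gz : gauge s z = 0.
    split => //; rewrite /push gz subr0 !mul0r subr0 divr1; case: z {Az Dz g0 gz} => t a /=.
    by congr pair; apply/funext => x; rewrite mul0r subr0 divr1.
  apply/le_anti; rewrite g0 andbT; case: Az => -[].
    move=> _ [_ [z0|z1]]; first by apply: le_trans (gauge_le_l _ _) _; rewrite z0 mulr0.
    by apply: le_trans (gauge_le_r _ _) _; rewrite z1 subrr mulr0.
  move=> [s' s'K1 sz] _; have /subsetPn[x xs xs'] := cofaces _ s'K1.
  apply: le_trans (gauge_le_coord _ xs) _.
  by case: sz => _ + _ => ->//; rewrite mulr0.
- move=> [t a] [[/= Kt Ea]|[/= [s' s'K1 st'] Ja]] [/= st Ja'].
    by rewrite gf//; exact: fC.
  (* Over an earlier simplex [s'] the point lies in the common face, which is proper and therefore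
     earlier as well; its carrier is contained in that of [s]. *)
  have sI := simplexI st' st; have s'I : s' :&: s \subset s by exact: finset.subsetIr.
  have IK : s' :&: s \in K1.
    apply: faces; last exact: simplex_neq0 sI.
    rewrite properE s'I /=; apply: contra (cofaces _ s'K1) => sI'.
    by apply: fintype.subset_trans sI' _; exact: finset.subsetIl.
  by apply: (Cmono _ _ _ _ s'I) => //; [exact: K1K|exact: gC].
move=> h [ch hg hC]; exists h; split.
- apply: continuous_subspaceW ch => z [?|[[s'] + st] Jz]; first by left; left.
  rewrite mem_rcons inE => /orP[/eqP s'E|s'K]; last by left; right; split => //; exists s'.
  by right; split => //=; rewrite -s'E.
- by move=> t a Kt Ea; rewrite hg ?gf//; left.
- move=> s' t a; rewrite mem_rcons inE => /orP[/eqP-> st Ja|s'K st Ja]; first exact: hC.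
  by rewrite hg; [exact: gC|right; split => //; exists s'].
Qed.

End Carrier.

(** * Order complexes *)

Section Realization.
Variables (R : realType) (T : finType).
Implicit Types (P Q : {set T}) (le : rel T).
Local Notation space := {ptws T -> R}.

Definition supp (t : T -> R) : {set T} := [set x | 0 < t x]%SET.

Definition chain P le (s : {set T}) :=
  [&& s != finset.set0, s \subset P & [forall x in s, forall y in s, le x y || le y x]].

(** Sorting by cardinality puts every face before its cofaces, as [carrier_extend] requires. *)
Definition chains P le : seq {set T} :=
  sort (fun s s' : {set T} => (#|s| <= #|s'|)%N) [seq s <- enum {set T} | chain P le s].

Lemma mem_chains P le s : (s \in chains P le) = chain P le s.
Proof. by rewrite mem_sort mem_filter mem_enum andbT. Qed.

Lemma chain_sub P le (s s' : {set T}) : s' != finset.set0 -> s' \subset s -> chain P le s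
  -> chain P le s'.
Proof.
move=> s'0 s's /and3P[_ sP /forall_inP sc]; apply/and3P; split => //.
  exact: fintype.subset_trans s's sP.
apply/forall_inP => x xs'; apply/forall_inP => y ys'.
have /forall_inP := sc x (fintype.subsetP s's _ xs').
by apply; exact: (fintype.subsetP s's).
Qed.

Lemma face_ordered_chains P le : face_ordered (chains P le).
Proof.
move=> K1 s K2 defK.
have total_c : total (fun s s' : {set T} => (#|s| <= #|s'|)%N) by move=> ? ?; exact: leq_total.
have trans_c : transitive (fun s s' : {set T} => (#|s| <= #|s'|)%N) by move=> ? ? ?;
  exact: leq_trans.
have := sort_sorted total_c [seq s <- enum {set T} | chain P le s].
rewrite -/(chains P le) defK (sorted_pairwise trans_c).
rewrite pairwise_cat /= => /and3P[/allrelP c12 _ /andP[/allP c2 _]].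
have uK : uniq (chains P le) by rewrite sort_uniq filter_uniq ?enum_uniq.
have sK : chain P le s by rewrite -mem_chains defK mem_cat mem_head orbT.
split=> s'.
  move=> ps' s'0; have : s' \in chains P le.
    by rewrite mem_chains; apply: chain_sub sK => //; exact: proper_sub.
  have lts := proper_card ps'.
  rewrite defK mem_cat inE => /or3P[//|/eqP s's|/c2].
    by move: lts; rewrite s's ltnn.
  by rewrite leqNgt lts.
move=> s'K; apply/negP => ss'.
have := c12 _ _ s'K (mem_head s K2) => /= les.
have /eqP e : s == s' by rewrite eqEcard ss'.
move: uK; rewrite defK cat_uniq => /and3P[_ /hasPn /(_ s) + _].
by rewrite mem_head e s'K => /(_ isT).
Qed.

Lemma simplex_supp P le t : realization_set R P le t -> simplex (supp t) t.
Proof.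
move=> [t0 tP t1 tc]; split => // x; rewrite inE -leNgt => tx.
by apply/le_anti; rewrite tx t0.
Qed.

Lemma chain_supp P le t : realization_set R P le t -> chain P le (supp t).
Proof.
move=> Pt; apply/and3P; split; first exact: simplex_neq0 (simplex_supp Pt).
  case: Pt => t0 tP _ _; apply/fintype.subsetP => x; rewrite inE.
  by apply: contraTT => /tP ->; rewrite ltxx.
apply/forall_inP => x; rewrite inE => tx; apply/forall_inP => y; rewrite inE => ty.
by case: Pt => _ _ _; apply.
Qed.

Lemma supp_simplex (s : {set T}) t : simplex s t -> supp t \subset s.
Proof.
move=> [_ ts _]; apply/fintype.subsetP => x; rewrite inE.
by apply: contraTT => /ts ->; rewrite ltxx.
Qed.

Lemma realization_body P le : realization_set R P le = body (chains P le).
Proof.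
apply/seteqP; split => t.
  by move=> Pt; exists (supp t); [rewrite mem_chains;
    exact: chain_supp Pt|exact: simplex_supp Pt].
move=> [s]; rewrite mem_chains => /and3P[_ sP /forall_inP sc] st; have ss := supp_simplex st.
case: st => t0 ts t1; split => // [x xP|x y tx ty].
  by apply: ts; apply: contra xP; exact: (fintype.subsetP sP).
have xs : x \in s by apply: (fintype.subsetP ss); rewrite inE.
have /forall_inP := sc _ xs; apply.
by apply: (fintype.subsetP ss); rewrite inE.
Qed.

Lemma closed_realization P le : closed (realization_set R P le).
Proof. by rewrite realization_body; exact: closed_body. Qed.

Lemma realization_restrict P Q le t : realization_set R P le t -> supp t \subset Q ->
  realization_set R Q le t.
Proof.
move=> [t0 tP t1 tc] tQ; split => // x xQ; apply/le_anti; rewrite t0 andbT leNgt.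
by apply: contra xQ => tx; apply: (fintype.subsetP tQ); rewrite inE.
Qed.

Lemma realization_supp P le t : realization_set R P le t -> supp t \subset P.
Proof. by move/chain_supp => /and3P[]. Qed.

Lemma realization_sub P Q le : P \subset Q -> realization_set R P le `<=` realization_set R
  Q le.
Proof.
move=> PQ t Pt; apply: realization_restrict (Pt) _.
exact: fintype.subset_trans (realization_supp Pt) PQ.
Qed.

(** Chains do not see the direction of the order, so order-reversing maps and fibres lying above a
    point need no separate theory. *)
Lemma realization_flip P le : realization_set R P (fun x y => le y x) = realization_set R P le.
Proof.
by apply/seteqP; split => t [t0 tP t1 tc]; split => // x y tx ty; rewrite orbC; exact: tc.
Qed.

(** A vertex comparable to all others can be added to any chain, so straight segments towards it
    stay in the realization. *)
Lemma cone_contractible P le m : m \in P -> le m m ->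
  (forall x, x \in P -> le x m || le m x) -> contractible R (realization_set R P le).
Proof.
move=> mP lemm lem.
pose c : space := fun x => (x == m)%:R.
pose h (z : R * space) : space := fun x => (1 - z.1) * z.2 x + z.1 * c x.
have sumc : \sum_x c x = 1.
  by rewrite (bigD1 m)//= big1 /c ?eqxx ?addr0// => x /negbTE ->.
have c0 x : 0 <= c x by rewrite ler0n.
exists c, h; split.
- split => // [x xP|x y].
    by rewrite /c; case: eqVneq => // xm; rewrite xm mP in xP.
  by rewrite /c; do 2 case: eqVneq => [->|_]; rewrite ?ltxx// lemm.
- apply: within_ptws => x.
  have c1 : continuous (fun z : R * space => z.1) by move=> z; exact: cvg_fst.
  have c2 : continuous (fun z : R * space => z.2 x).
    move=> z; apply: (@continuous_comp _ _ _ snd (fun t : space => t x)); first exact: cvg_snd.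
    exact: ptws_coord_continuous.
  have c3 : continuous (fun z : R * space => 1 - z.1).
    exact: (@contB _ _ (fun=> 1) _ (cont_cst (a := 1)) c1).
  have c4 := @contM _ _ _ (fun=> c x) c1 (cont_cst (a := c x)).
  by apply: continuous_subspaceT; exact: contD (contM c3 c2) c4.
- move=> s t /andP[s0 s1] Pt; case: (Pt) => t0 tP t1 tc; split => [x|x xP||x y].
  + by rewrite /h addr_ge0// mulr_ge0//= subr_ge0.
  + rewrite /h /= tP// mulr0 add0r /c; case: eqVneq => [xm|]; last by rewrite mulr0.
    by rewrite xm mP in xP.
  + by rewrite big_split /= -!mulr_sumr t1 sumc !mulr1 subrK.
  + have hx z : 0 < h (s, t) z -> 0 < t z \/ z = m.
      rewrite /h /c /=; case: eqVneq => [->|_]; first by right.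
      rewrite mulr0 addr0 => tz; left; rewrite lt_neqAle t0 andbT eq_sym.
      by apply: contraTneq tz => ->; rewrite mulr0 ltxx.
    have inP z : 0 < t z -> z \in P.
      by move=> tz; apply: (fintype.subsetP (realization_supp Pt)); rewrite inE.
    case/hx => [tx|->] /hx[ty|->].
    * exact: tc.
    * exact/lem/inP.
    * rewrite orbC; exact/lem/inP.
    * by rewrite lemm.
- by move=> t _; apply/funext => x; rewrite /h /= subr0 mul1r mul0r addr0.
- by move=> t _; apply/funext => x; rewrite /h /= subrr mul0r mul1r add0r.
Qed.

End Realization.

Lemma closed_setX (X Y : topologicalType) (A : set X) (B : set Y) :
  closed A -> closed B -> closed (A `*` B).
Proof.
move=> cA cB; have -> : A `*` B = (fst @^-1` A) `&` (snd @^-1` B) by [].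
by apply: closedI; apply: closed_comp => // z _; [exact: cvg_fst|exact: cvg_snd].
Qed.

(** * Homotopy equivalences of subsets *)

Section HomotopyEquivalence.
Variable R : realType.

(** Spaces are subsets, and maps are total functions whose values off the subset are irrelevant;
    this spares subspace types until the final transfer. *)
Definition homotopic_on (X Y : topologicalType) (A : set X) (B : set Y) (f g : X -> Y) :=
  exists H : R * X -> Y, [/\ {within unit_itv R `*` A, continuous H},
    forall s x, unit_itv R s -> A x -> B (H (s, x)),
    forall x, A x -> H (0, x) = f x & forall x, A x -> H (1, x) = g x].

Definition hequiv (X Y : topologicalType) (A : set X) (B : set Y) :=
  exists (f : X -> Y) (g : Y -> X),
   [/\ {within A, continuous f} /\ {within B, continuous g},
       forall x, A x -> B (f x), forall y, B y -> A (g y),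
       homotopic_on A A (g \o f) id & homotopic_on B B (f \o g) id].

Lemma hequiv_sym (X Y : topologicalType) (A : set X) (B : set Y) : hequiv A B -> hequiv B A.
Proof. by move=> [f [g [[cf cg] fAB gBA hA hB]]]; exists g, f. Qed.

Lemma homotopic_trans (X Y : topologicalType) (A : set X) (B : set Y) f g h :
  closed A -> homotopic_on A B f g -> homotopic_on A B g h -> homotopic_on A B f h.
Proof.
move=> cA [H1 [c1 B1 f1 g1]] [H2 [c2 B2 f2 g2]].
pose H z := if z.1 <= 2^-1 then H1 (2 * z.1, z.2) else H2 (2 * z.1 - 1, z.2).
have HE1 z : A z.2 -> z.1 <= 2^-1 -> H1 (2 * z.1, z.2) = H z by rewrite /H => _ ->.
have HE2 z : A z.2 -> 2^-1 <= z.1 -> H2 (2 * z.1 - 1, z.2) = H z.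
  move=> Az hz; rewrite /H; case: ifPn => // hz'.
  have -> : z.1 = 2^-1 by apply/le_anti/andP.
  by rewrite mulfV// subrr f2// g1.
exists H; split.
- pose U1 := [set s : R | 0 <= s] `&` [set s | s <= 2^-1].
  pose U2 := [set s : R | 2^-1 <= s] `&` [set s | s <= 1].
  have cU1 : closed U1 by apply: closedI; [exact: closed_ge|exact: closed_le].
  have cU2 : closed U2 by apply: closedI; [exact: closed_ge|exact: closed_le].
  have -> : unit_itv R `*` A = (U1 `*` A) `|` (U2 `*` A).
    apply/seteqP; split => -[s x] /=.
      move=> [/andP[s0 s1] Ax]; case: (leP s 2^-1) => [|/ltW] hs; [by left|by right].
    move=> [[[/= h1 h2] Ax]|[[/= h1 h2] Ax]]; split => //; rewrite /unit_itv/=; lra.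
  have cm (P : set (R * X)) (k l : R) : {within P, continuous (fun z : R * X =>
    (k * z.1 - l, z.2))}.
    have cf : continuous (fun z : R * X => z.1) by move=> z; exact: cvg_fst.
    apply: within_pair; apply: continuous_subspaceT; last by move=> z; exact: cvg_snd.
    exact: (@contB _ _ _ (fun=> l) (@contM _ _ (fun=> k) _ (cont_cst (a := k)) cf)
      (cont_cst (a := l))).
  apply: withinU_continuous; [exact: closed_setX|exact: closed_setX| |].
  + apply: (@within_eq _ _ _ (fun z : R * X => H1 (2 * z.1 - 0, z.2))).
      by move=> z [[? ?] ?]; rewrite subr0 HE1.
    apply: (@within_comp _ _ _ _ (unit_itv R `*` A) (fun z : R * X =>
      (2 * z.1 - 0, z.2)) H1) => //.
    by move=> z [[/= ? ?] ?]; split => //; rewrite /unit_itv/=; lra.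
  + apply: (@within_eq _ _ _ (fun z : R * X => H2 (2 * z.1 - 1, z.2))).
      by move=> z [[? ?] ?]; rewrite HE2.
    apply: (@within_comp _ _ _ _ (unit_itv R `*` A) (fun z : R * X =>
      (2 * z.1 - 1, z.2)) H2) => //.
    by move=> z [[/= ? ?] ?]; split => //; rewrite /unit_itv/=; lra.
- move=> s x /andP[s0 s1] Ax; rewrite /H /=; case: leP => hs.
    by apply: B1 => //; rewrite /unit_itv/=; lra.
  by apply: B2 => //; rewrite /unit_itv/=; lra.
- by move=> x Ax; rewrite /H /= invr_ge0 ler0n mulr0 f1.
- move=> x Ax; rewrite -(HE2 (1, x))//= ?mulr1; last by lra.
  by rewrite (_ : 2 - 1 = 1 :> R) ?g2//; lra.
Qed.

Lemma homotopic_comp (X X' Y Y' : topologicalType) (A : set X) (A' : set X') (B : set Y)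
   (B' : set Y') (k : X' -> X) (l : Y -> Y') f g :
  {within A', continuous k} -> (forall x, A' x -> A (k x)) ->
  {within B, continuous l} -> (forall x, B x -> B' (l x)) ->
  homotopic_on A B f g -> homotopic_on A' B' (l \o f \o k) (l \o g \o k).
Proof.
move=> ck kA cl lB [H [cH HB H0 H1]].
exists (fun z => l (H (z.1, k z.2))); split.
- apply: (@within_comp _ _ _ _ B (fun z => H (z.1, k z.2)) l) => //.
    by move=> [s x] [/= ? ?]; apply: HB => //; exact: kA.
  apply: (@within_comp _ _ _ _ (unit_itv R `*` A) (fun z => (z.1, k z.2)) H) => //.
    by move=> [s x] [/= ? ?]; split => //; exact: kA.
  apply: within_pair; first by apply: continuous_subspaceT => z; exact: cvg_fst.
  apply: (@within_comp _ _ _ _ A' snd k) => //; first by move=> z [].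
  by apply: continuous_subspaceT => z; exact: cvg_snd.
- by move=> s x us Ax; apply: lB; apply: HB => //; exact: kA.
- by move=> x Ax /=; rewrite H0//; exact: kA.
- by move=> x Ax /=; rewrite H1//; exact: kA.
Qed.

Lemma hequiv_trans (X Y Z : topologicalType) (A : set X) (B : set Y) (C : set Z) :
  closed A -> closed C -> hequiv A B -> hequiv B C -> hequiv A C.
Proof.
move=> cA cC [f [g [[cf cg] fAB gBA hA hB]]] [f' [g' [[cf' cg'] fBC gCB hB' hC]]].
exists (f' \o f), (g \o g'); split.
- by split; apply: within_comp; eauto.
- by move=> x Ax; apply/fBC/fAB.
- by move=> x Ax; apply/gBA/gCB.
- apply: homotopic_trans hA => //.
  exact: (homotopic_comp cf fAB cg gBA hB').
- apply: homotopic_trans hC => //.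
  exact: (homotopic_comp cg' gCB cf' fBC hB).
Qed.

Lemma hequiv_prod (X Y X' Y' : topologicalType) (A : set X) (B : set Y) (A' : set X') (B' :
  set Y') :
  hequiv A A' -> hequiv B B' -> hequiv (A `*` B) (A' `*` B').
Proof.
have aux (U V U' V' : topologicalType) (C : set U) (D : set V) (C' : set U') (D' : set V')
    (f : U -> U') (g : V -> V') : {within C, continuous f} -> {within D, continuous g} ->
    {within C `*` D, continuous (fun z => (f z.1, g z.2))}.
  move=> cf cg; apply: within_pair.
    apply: (@within_comp _ _ _ _ C fst f) => //; first by move=> z [].
    by apply: continuous_subspaceT => z; exact: cvg_fst.
  apply: (@within_comp _ _ _ _ D snd g) => //; first by move=> z [].
  by apply: continuous_subspaceT => z; exact: cvg_snd.
have auxh (U V : topologicalType) (C : set U) (D : set V) (f : U -> U) (g : V -> V) :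
   homotopic_on C C f id -> homotopic_on D D g id ->
   homotopic_on (C `*` D) (C `*` D) (fun z => (f z.1, g z.2)) id.
  move=> [H [cH HB H0 H1]] [K [cK KB K0 K1]].
  exists (fun z => (H (z.1, z.2.1), K (z.1, z.2.2))); split.
  - have cs : continuous (fun z : R * (U * V) => z.2) by move=> z; exact: cvg_snd.
    apply: within_pair.
      apply: (@within_comp _ _ _ _ (unit_itv R `*` C) (fun z : R * (U * V) =>
        (z.1, z.2.1)) H) => //.
        by move=> [s [x y]] [/= ? []].
      apply: within_pair; apply: continuous_subspaceT => z; first exact: cvg_fst.
      by apply: (@continuous_comp _ _ _ snd fst); [exact: cs|exact: cvg_fst].
    apply: (@within_comp _ _ _ _ (unit_itv R `*` D) (fun z : R * (U * V) =>
      (z.1, z.2.2)) K) => //.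
      by move=> [s [x y]] [/= ? []].
    apply: within_pair; apply: continuous_subspaceT => z; first exact: cvg_fst.
    by apply: (@continuous_comp _ _ _ snd snd); [exact: cs|exact: cvg_snd].
  - by move=> s [x y] us [/= Cx Dy]; split; [exact: HB|exact: KB].
  - by move=> [x y] [/= Cx Dy]; rewrite H0// K0.
  - by move=> [x y] [/= Cx Dy]; rewrite H1// K1.
move=> [f [g [[cf cg] fAB gBA hA hB]]] [f' [g' [[cf' cg'] fBC gCB hB' hC]]].
exists (fun z => (f z.1, f' z.2)), (fun z => (g z.1, g' z.2)); split.
- by split; apply: aux.
- by move=> z [? ?]; split; [exact: fAB|exact: fBC].
- by move=> z [? ?]; split; [exact: gBA|exact: gCB].
- exact: auxh hA hB'.
- exact: auxh hB hC.
Qed.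

Lemma contractible_hequiv (X Y : topologicalType) (A : set X) (B : set Y) :
  closed A -> hequiv A B -> contractible R B -> contractible R A.
Proof.
move=> cA [f [g [[cf cg] fAB gBA hA hB]]] [c [h [Bc ch hB' h0 h1]]].
have h2 : homotopic_on A A (g \o f) (fun=> g c).
  have : homotopic_on B B id (fun=> c) by exists h; split.
  by move/(homotopic_comp cf fAB cg gBA).
have h3 : homotopic_on A A id (g \o f).
  case: hA => H [cH HB H0 H1].
  exists (fun z : R * X => H (1 - z.1, z.2)); split.
  - apply: (@within_comp _ _ _ _ (unit_itv R `*` A) (fun z : R * X => (1 - z.1, z.2)) H) => //.
      by move=> z [/andP[? ?] ?]; split => //; rewrite /unit_itv/=; lra.
    apply: within_pair; apply: continuous_subspaceT; last by move=> z; exact: cvg_snd.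
    apply: (@contB _ _ (fun=> 1)); first exact: (cont_cst (a := 1)).
    by move=> z; exact: cvg_fst.
  - by move=> s x /andP[? ?] Ax; apply: HB => //; rewrite /unit_itv/=; lra.
  - by move=> x Ax; rewrite subr0 H1.
  - by move=> x Ax; rewrite subrr H0.
have [H [cH HB H0 H1]] := homotopic_trans cA h3 h2.
by exists (g c), H; split => //; exact: gBA.
Qed.

End HomotopyEquivalence.

(** * Maps carried by a monotone family of contractible subposets *)

Section PosetCarrier.
Variables (R : realType) (T T' : finType) (P : {set T}) (le : rel T) (le' : rel T').
Variable B : T -> {set T'}.
Hypothesis Bmono : forall p q, p \in P -> q \in P -> le p q -> B p \subset B q.
Hypothesis Bctr : forall p, p \in P -> contractible R (realization_set R (B p) le').

Definition carried (f : {ptws T -> R} -> {ptws T' -> R}) :=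
  forall t, realization_set R P le t ->
    realization_set R (\bigcup_(p in supp t) B p)%SET le' (f t).

Let C (s : {set T}) := realization_set R (\bigcup_(p in s) B p)%SET le'.

(** The member with the largest [B p] acts as the top of the chain: by comparability and
    monotonicity the other [B q] are contained in it, so the union over the chain is a single
    contractible [B p]. *)
Let CB (s : {set T}) : chain P le s -> exists2 p, p \in P & C s = realization_set R (B p) le'.
Proof.
move=> /and3P[/finset.set0Pn[x0 x0s] /fintype.subsetP sP /forall_inP sc].
case: (arg_maxnP (fun p => #|B p|) x0s) => m ms mmax.
exists m; first exact: sP.
rewrite /C; congr (realization_set R _ le'); apply/eqP; rewrite finset.eqEsubset.
apply/andP; split; last exact: finset.bigcup_sup.
apply/finset.bigcupsP => q qs.
have /forall_inP /(_ _ qs) /orP[mq|qm] := sc _ ms; last by apply: Bmono => //; exact: sP.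
have := Bmono (sP _ ms) (sP _ qs) mq.
by rewrite subEproper => /orP[/eqP ->//|/proper_card]; have /= := mmax _ qs;
  rewrite ltnNge => ->.
Qed.

Let Cctr s : s \in chains P le -> contractible R (C s).
Proof. by rewrite mem_chains => /CB[p pP ->]; exact: Bctr. Qed.

Let Cmono (s s' : {set T}) : s' \in chains P le -> s \in chains P le -> s' \subset s -> C
  s' `<=` C s.
Proof.
move=> _ _ ss; apply: realization_sub; apply/finset.bigcupsP => p ps.
by apply: finset.bigcup_sup; exact: (fintype.subsetP ss).
Qed.

Lemma carried_exists : exists f, {within realization_set R P le, continuous f} /\ carried f.
Proof.
(* At a single interior time the prisms have no ends, so there are no boundary values to prescribe
   and the initial map is arbitrary. *)
have [] := @carrier_extend R T {ptws T' -> R} (chains P le) [set 2^-1] C (fun=> (fun=> 0))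
  _ _ _ _ Cctr Cmono.
- exact: face_ordered_chains.
- exact: closed_eq.
- by move=> a ->; lra.
- move=> a s -> /andP[s0 s2] _ _ /=; apply: (@mulIf _ (1 - s)); first by apply/eqP; lra.
  by rewrite mulfVK; [lra|apply/eqP; lra].
- have -> : [set 2^-1] `&` [set a : R | a = 0 \/ a = 1] = set0.
    by apply/seteqP; split => a //= [-> []]; lra.
  by rewrite setX0; exact: continuous_subspace0.
- by move=> s t a _ _ [-> /= []]; lra.
move=> g [cg _ gC]; exists (fun t => g (t, 2^-1)); split.
  apply: (@within_comp _ _ _ _ (body (R := R) (chains P le) `*` [set (2^-1 : R)]) (fun t :
    {ptws T -> R} => (t, 2^-1 : R)) g) => //.
    by move=> t; rewrite realization_body.
  apply: within_pair; apply: continuous_subspaceT; first by move=> x.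
  exact: (cont_cst (a := 2^-1)).
move=> t Pt; apply: gC => //; first by rewrite mem_chains; exact: chain_supp Pt.
exact: simplex_supp Pt.
Qed.

Lemma carried_homotopic (Q : {set T'}) (f g : {ptws T -> R} -> {ptws T' -> R}) :
  (forall p, p \in P -> B p \subset Q) ->
  {within realization_set R P le, continuous f} ->
  {within realization_set R P le, continuous g} -> carried f -> carried g ->
  homotopic_on R (realization_set R P le) (realization_set R Q le') f g.
Proof.
move=> BQ cf cg Cf Cg.
have carr k s t : carried k -> s \in chains P le -> simplex s t -> C s (k t).
  move=> Ck sK st; have Pt : realization_set R P le t.
    by rewrite realization_body; exists s.
  apply: realization_sub (Ck t Pt); apply/finset.bigcupsP => p pt.
  by apply: finset.bigcup_sup; exact: (fintype.subsetP (supp_simplex st)).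
pose k (z : {ptws T -> R} * R) := if z.2 == 0 then f z.1 else g z.1.
have cE (a : R) : closed (body (chains P le) `*` [set a] : set ({ptws T -> R} * R)).
  have -> : (body (chains P le) `*` [set a] : set ({ptws T -> R} * R)) =
      (fst @^-1` (body (chains P le))) `&` (snd @^-1` [set a]) by [].
  apply: closedI.
    by apply: closed_comp => [z _|]; [exact: cvg_fst|exact: closed_body].
  by apply: closed_comp => [z _|]; [exact: cvg_snd|exact: closed_eq].
have [] := @carrier_extend R T {ptws T' -> R} (chains P le) (unit_itv R) C k _ _ _ _ Cctr Cmono.
- exact: face_ordered_chains.
- have -> : unit_itv R = [set s | 0 <= s] `&` [set s | s <= 1].
    by apply/seteqP; split => s /=; [move/andP|move=> ?; apply/andP].
  by apply: closedI; [exact: closed_ge|exact: closed_le].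
- by [].
- move=> a s /andP[a0 a1] /andP[s0 s2] sa sa'.
  rewrite /unit_itv /= divr_ge0 ?ler_pdivrMr; lra.
- have -> : unit_itv R `&` [set a : R | a = 0 \/ a = 1] = [set 0] `|` [set 1].
    apply/seteqP; split => a /=; first by case.
    by move=> h; split => //; case: h => ->; rewrite /unit_itv /= ?lexx ?ler01.
  have -> : body (R := R) (chains P le) `*` ([set (0 : R)] `|` [set 1]) =
      (body (chains P le) `*` [set 0]) `|` (body (chains P le) `*` [set 1]).
    by apply/seteqP; split => -[t a] /=; tauto.
  apply: withinU_continuous => //.
    apply: (@within_eq _ _ _ (fun z : {ptws T -> R} * R => f z.1)).
      by move=> [t a] [/= _ ->]; rewrite /k /= eqxx.
    apply: (@within_comp _ _ _ _ (realization_set R P le) fst f) => //.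
      by move=> [t a] [/= + _]; rewrite realization_body.
    by apply: continuous_subspaceT => z; exact: cvg_fst.
  apply: (@within_eq _ _ _ (fun z : {ptws T -> R} * R => g z.1)).
    by move=> [t a] [/= _ ->]; rewrite /k /= oner_eq0.
  apply: (@within_comp _ _ _ _ (realization_set R P le) fst g) => //.
    by move=> [t a] [/= + _]; rewrite realization_body.
  by apply: continuous_subspaceT => z; exact: cvg_fst.
- by move=> s t a sK st _; rewrite /k /=; case: ifP => _; exact: carr.
move=> H [cH Hk HC]; exists (fun z : R * {ptws T -> R} => H (z.2, z.1)); split.
- apply: (@within_comp _ _ _ _ (body (R := R) (chains P le) `*` unit_itv R) (fun z : R *
  {ptws T -> R} => (z.2, z.1)) H) => //.
    by move=> [s t] [/= ? ]; rewrite realization_body.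
  by apply: within_pair; apply: continuous_subspaceT => z; [exact: cvg_snd|exact: cvg_fst].
- move=> s t us Pt; have sK : supp t \in chains P le.
    by rewrite mem_chains; exact: chain_supp Pt.
  have := HC _ _ _ sK (simplex_supp Pt) us.
  apply: realization_sub; apply/finset.bigcupsP => p pt; apply: BQ.
  exact: (fintype.subsetP (realization_supp Pt)).
- move=> t; rewrite realization_body => Pt; rewrite Hk//; first by rewrite /k /= eqxx.
  by split; [rewrite /unit_itv /= lexx ler01|left].
- move=> t; rewrite realization_body => Pt; rewrite Hk//; first by rewrite /k /= oner_eq0.
  by split; [rewrite /unit_itv /= lexx ler01|right].
Qed.

End PosetCarrier.

Lemma sum_gt0_ex (R : realType) (I : finType) (P : pred I) (F : I -> R) :
  0 < \sum_(i | P i) F i -> exists2 i, P i & 0 < F i.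
Proof.
move=> F0; case: (pickP [pred i | P i && (0 < F i)]) => [i /andP[Pi Fi]|no].
  by exists i.
suff : \sum_(i | P i) F i <= 0 by rewrite leNgt F0.
apply: sumr_le0 => i Pi; rewrite leNgt; apply/negP => Fi.
by have := no i; rewrite /= Pi Fi.
Qed.

(** * Quillen's fibre lemma *)

Section Pushforward.
Variables (R : realType) (T T' : finType) (P : {set T}) (le : rel T) (P' : {set T'}) (le' :
  rel T').
Variable phi : T -> T'.
Hypothesis phiP : forall p, p \in P -> phi p \in P'.
Hypothesis phi_mono : forall p q, p \in P -> q \in P -> le p q -> le' (phi p) (phi q).

Definition map_weights (t : {ptws T -> R}) : {ptws T' -> R} :=
  fun q => \sum_(p | phi p == q) t p.

Lemma continuous_map_weights : continuous map_weights.
Proof.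
apply/continuous_subspace_setT; apply: within_ptws => q.
apply: continuous_subspaceT; apply: continuous_sum => p.
exact: ptws_coord_continuous.
Qed.

Lemma supp_map_weights t q : q \in supp (map_weights t) -> exists2 p, p \in supp t & phi p = q.
Proof. by rewrite inE => /sum_gt0_ex[p /eqP pq tp]; exists p; rewrite ?inE. Qed.

Lemma realization_map_weights t : realization_set R P le t ->
  realization_set R P' le' (map_weights t).
Proof.
move=> Pt; have [t0 tP t1 tc] := Pt; split => [q|q qP'||q q'].
- by apply: sumr_ge0 => p _; exact: t0.
- apply: big1 => p /eqP pq; apply: tP; apply: contra qP' => pP.
  by rewrite -pq; exact: phiP.
- by rewrite -t1 (partition_big phi predT)//.
- move=> tq tq'; have /supp_map_weights[p pt <-] : q \in supp (map_weights t) by rewrite inE.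
  have /supp_map_weights[p' pt' <-] : q' \in supp (map_weights t) by rewrite inE.
  have inP := fintype.subsetP (realization_supp Pt).
  have [pP pP'] := (inP _ pt, inP _ pt').
  move: pt pt'; rewrite !inE => pt pt'.
  by case/orP: (tc _ _ pt pt') => h; apply/orP; [left|right]; exact: phi_mono.
Qed.

Hypothesis le'_refl : forall q, q \in P' -> le' q q.
Hypothesis le'_trans : forall a b c,
  a \in P' -> b \in P' -> c \in P' -> le' a b -> le' b c -> le' a c.
Hypothesis fibre_ctr : forall q, q \in P' ->
  contractible R (realization_set R [set p in P | le' (phi p) q]%SET le).

(* Quillen's Theorem A: the homotopy inverse is any map carried by the fibres. *)
Lemma quillen : hequiv R (realization_set R P le) (realization_set R P' le').
Proof.
pose F := map_weights.
pose B p := [set q in P' | le' q (phi p)]%SET.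
pose B' q := [set p in P | le' (phi p) q]%SET.
(* Carriers of the two homotopies: [D'] consists of fibres and carries [G \o F] and the identity;
   [D] consists of cones with a greatest element and carries [F \o G] and the identity. *)
pose D q := [set q' in P' | le' q' q]%SET.
pose D' p := [set p' in P | le' (phi p') (phi p)]%SET.
have B'mono p q : p \in P' -> q \in P' -> le' p q -> B' p \subset B' q.
  move=> pP qP pq; apply/fintype.subsetP => x; rewrite !inE => /andP[xP xp].
  by rewrite xP /=; apply: le'_trans pq => //; exact: phiP.
have Dmono p q : p \in P' -> q \in P' -> le' p q -> D p \subset D q.
  move=> pP qP pq; apply/fintype.subsetP => x; rewrite !inE => /andP[xP xp].
  by rewrite xP /=; apply: le'_trans pq.
have Dctr q : q \in P' -> contractible R (realization_set R (D q) le').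
  move=> qP; apply: (@cone_contractible R T' (D q) le' q); rewrite ?inE ?qP ?le'_refl//.
  by move=> x; rewrite inE => /andP[_ ->].
have D'mono p q : p \in P -> q \in P -> le p q -> D' p \subset D' q.
  by move=> pP qP pq; apply: B'mono; [exact: phiP|exact: phiP|exact: phi_mono].
have D'ctr p : p \in P -> contractible R (realization_set R (D' p) le).
  by move=> pP; apply: fibre_ctr; exact: phiP.
have [G [cG CG]] := carried_exists B'mono fibre_ctr.
have cF : {within realization_set R P le, continuous F}.
  by apply: continuous_subspaceT; exact: continuous_map_weights.
have GP t : realization_set R P' le' t -> realization_set R P le (G t).
  move=> Pt; apply: realization_sub (CG _ Pt); apply/finset.bigcupsP => q _.
  by apply/fintype.subsetP => x; rewrite inE => /andP[].
have FP := realization_map_weights.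
exists F, G; split => //.
- apply: (@carried_homotopic _ _ _ _ _ _ D' D'mono D'ctr).
  + by move=> p _; apply/fintype.subsetP => x; rewrite inE => /andP[].
  + by apply: within_comp cG => // t /FP.
  + by apply: continuous_subspaceT => x; exact: cvg_id.
  + move=> t Pt; have := CG _ (FP _ Pt); apply: realization_sub.
    apply/finset.bigcupsP => q /supp_map_weights[p pt <-].
    exact: (finset.bigcup_sup p).
  + move=> t Pt; apply: realization_restrict (Pt) _; apply/fintype.subsetP => p pt.
    apply/finset.bigcupP; exists p => //; have pP := fintype.subsetP (realization_supp Pt) _ pt.
    by rewrite inE pP le'_refl//; exact: phiP.
- apply: (@carried_homotopic _ _ _ _ _ _ D Dmono Dctr).
  + by move=> p _; apply/fintype.subsetP => x; rewrite inE => /andP[].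
  + by apply: within_comp cF => // t /GP.
  + by apply: continuous_subspaceT => x; exact: cvg_id.
  + move=> t Pt; apply: realization_restrict (FP _ (GP _ Pt)) _.
    apply/fintype.subsetP => q /supp_map_weights[p pt <-].
    have /finset.bigcupP[q' q't] := fintype.subsetP (realization_supp (CG _ Pt)) _ pt.
    rewrite inE => /andP[pP pq']; apply/finset.bigcupP; exists q' => //.
    by rewrite inE phiP.
  + move=> t Pt; apply: realization_restrict (Pt) _; apply/fintype.subsetP => p pt.
    apply/finset.bigcupP; exists p => //; have pP := fintype.subsetP (realization_supp Pt) _ pt.
    by rewrite inE pP le'_refl.
Qed.

End Pushforward.

(** * Products *)

Section Product.
Variables (R : realType) (T T' : finType) (P : {set T}) (le : rel T) (Q : {set T'}) (le' :
  rel T').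

Definition prod_le : rel (T * T') := fun z w => le z.1 w.1 && le' z.2 w.2.

Definition poset_on (S : finType) (A : {set S}) (r : rel S) :=
  [/\ forall x, x \in A -> r x x,
      forall x y, x \in A -> y \in A -> r x y -> r y x -> x = y &
      forall x y z, x \in A -> y \in A -> z \in A -> r x y -> r y z -> r x z].

(** For a vertex [p] of the chain supporting [t], this is the left end of the subinterval of [0, 1]
    that belongs to [p]. *)
Definition lower (S : finType) (r : rel S) (t : {ptws S -> R}) (p : S) : R :=
  \sum_(x | (x != p) && r x p) t x.

Lemma lower_ge0 (S : finType) (A : {set S}) (r : rel S) t p :
  realization_set R A r t -> 0 <= lower r t p.
Proof. by move=> [t0 _ _ _]; exact: sumr_ge0. Qed.

Lemma lower_lt (S : finType) (A : {set S}) (r : rel S) t p q : poset_on A r ->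
  realization_set R A r t -> p \in A -> q \in A -> r p q -> p != q ->
  lower r t p + t p <= lower r t q.
Proof.
move=> [rr ra rt] At pA qA rpq pq; have [t0 tA _ _] := At.
rewrite /lower [leLHS]addrC [in leRHS](bigD1 p) ?pq//= lerD2l.
rewrite big_mkcond [leRHS]big_mkcond /=; apply: ler_sum => x _.
case: (boolP (x \in A)) => xA; last by rewrite tA// !if_same.
case: ifP => [/andP[xp xrp]|_]; last by case: ifP => _.
rewrite xp (rt _ p)//= !andbT; case: eqVneq => // xq; move: xp.
by rewrite (ra _ _ pA xA) ?eqxx// xq.
Qed.

(** Some subinterval starts at 0; taken in both factors, this yields a pair with positive
    overlap. *)
Lemma lower_min (S : finType) (A : {set S}) (r : rel S) t : poset_on A r ->
  realization_set R A r t -> exists2 p, p \in supp t & lower r t p = 0.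
Proof.
move=> Ar At; have /finset.set0Pn[x0 x0t] := simplex_neq0 (simplex_supp At).
have inA := fintype.subsetP (realization_supp At).
case: (arg_minP (lower r t) x0t) => m mt mmin; exists m => //.
apply/le_anti; rewrite (lower_ge0 _ At) andbT leNgt;
  apply/negP => /sum_gt0_ex[x /andP[xm rxm] tx].
have xt : x \in supp t by rewrite inE.
have := lower_lt Ar At (inA _ xt) (inA _ mt) rxm xm.
by have := mmin _ xt; lra.
Qed.

Hypotheses (Pposet : poset_on P le) (Qposet : poset_on Q le').

(* Points of the two realizations cut the unit interval into consecutive
   subintervals, whose overlaps weigh the pairs of vertices. *)
Definition overlap (t : {ptws T -> R}) (u : {ptws T' -> R}) (z : T * T') : R :=
  Num.max 0 (Num.min (lower le t z.1 + t z.1) (lower le' u z.2 + u z.2)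
             - Num.max (lower le t z.1) (lower le' u z.2)).

(** On points of the two realizations the overlaps add up to 1, so the division changes nothing; it
    reduces what has to be checked to the positivity of the sum. *)
Definition staircase (tu : {ptws T -> R} * {ptws T' -> R}) : {ptws T * T' -> R} :=
  fun z => overlap tu.1 tu.2 z / \sum_w overlap tu.1 tu.2 w.

Lemma overlap_ge0 t u z : 0 <= overlap t u z.
Proof. by rewrite /overlap le_max lexx. Qed.

Lemma overlap_gt0 t u z : 0 < overlap t u z ->
  [/\ 0 < t z.1, 0 < u z.2, lower le' u z.2 < lower le t z.1 + t z.1 &
      lower le t z.1 < lower le' u z.2 + u z.2].
Proof.
rewrite /overlap lt_max ltxx /= subr_gt0 lt_min !gt_max.
by move=> /andP[/andP[h1 h2] /andP[h3 h4]]; split => //; lra.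
Qed.

Lemma sum_overlap_gt0 t u : realization_set R P le t -> realization_set R Q le' u ->
  0 < \sum_w overlap t u w.
Proof.
move=> Pt Qu; have [p pt p0] := lower_min Pposet Pt; have [q qu q0] := lower_min Qposet Qu.
rewrite (bigD1 (p, q))//= ltr_pwDl//; last by apply: sumr_ge0 => z _; exact: overlap_ge0.
move: pt qu; rewrite !inE => pt qu.
by rewrite /overlap /= p0 q0 !add0r maxxx subr0 lt_max lt_min pt qu orbT.
Qed.

Lemma staircase_gt0 t u z : realization_set R P le t -> realization_set R Q le' u ->
  0 < staircase (t, u) z -> 0 < overlap t u z.
Proof. by move=> Pt Qu; rewrite /staircase /= pmulr_lgt0// invr_gt0;
  exact: sum_overlap_gt0. Qed.

Lemma realization_staircase t u : realization_set R P le t -> realization_set R Q le' u ->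
  realization_set R (finset.setX P Q) prod_le (staircase (t, u)).
Proof.
move=> Pt Qu; have S0 := sum_overlap_gt0 Pt Qu; have [Pr Pa Ptr] := Pposet;
  have [Qr Qa Qtr] := Qposet.
have inP := fintype.subsetP (realization_supp Pt);
  have inQ := fintype.subsetP (realization_supp Qu).
have oP z : 0 < overlap t u z -> z.1 \in P /\ z.2 \in Q.
  by move=> /overlap_gt0[tz uz _ _]; split; [apply: inP|apply: inQ]; rewrite inE.
split => [z|z zPQ||z w].
- by rewrite /staircase /= divr_ge0 ?overlap_ge0// ltW.
- rewrite /staircase /=; suff -> : overlap t u z = 0 by rewrite mul0r.
  apply/le_anti; rewrite overlap_ge0 andbT leNgt; apply: contra zPQ => /oP[].
  by case: z => p q /= pP qQ; rewrite finset.in_setX pP qQ.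
- by rewrite /staircase /= -mulr_suml divff// gt_eqF.
move=> /staircase_gt0 => /(_ Pt Qu) oz /staircase_gt0 => /(_ Pt Qu) ow.
have [[zP zQ] [wP wQ]] := (oP _ oz, oP _ ow).
have [tz uz z1 z2] := overlap_gt0 oz; have [tw uw w1 w2] := overlap_gt0 ow.
have [_ _ _ tc] := Pt; have [_ _ _ uc] := Qu.
have tzw := tc _ _ tz tw; have uzw := uc _ _ uz uw.
rewrite /prod_le.
case: (eqVneq z.1 w.1) => [e|nP]; first by rewrite !e !Pr.
case: (eqVneq z.2 w.2) => [e|nQ]; first by rewrite !e !Qr ?andbT.
(* Opposite strict comparisons in the two coordinates are impossible: the ends of the four
   subintervals would increase cyclically. *)
case/orP: tzw => hP; case/orP: uzw => hQ; rewrite ?hP ?hQ ?orbT//.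
- have := lower_lt Pposet Pt zP wP hP nP; rewrite eq_sym in nQ.
  by have := lower_lt Qposet Qu wQ zQ hQ nQ; lra.
- have := lower_lt Qposet Qu zQ wQ hQ nQ; rewrite eq_sym in nP.
  by have := lower_lt Pposet Pt wP zP hP nP; lra.
Qed.

Lemma continuous_overlap z : continuous (fun tu => overlap tu.1 tu.2 z).
Proof.
have c1 p : continuous (fun tu : {ptws T -> R} * {ptws T' -> R} => tu.1 p).
  move=> x; apply: (@continuous_comp _ _ _ fst (fun t : {ptws T -> R} => t p));
    first exact: cvg_fst.
  exact: ptws_coord_continuous.
have c2 p : continuous (fun tu : {ptws T -> R} * {ptws T' -> R} => tu.2 p).
  move=> x; apply: (@continuous_comp _ _ _ snd (fun t : {ptws T' -> R} => t p));
    first exact: cvg_snd.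
  exact: ptws_coord_continuous.
have l1 p : continuous (fun tu : {ptws T -> R} * {ptws T' -> R} => lower le tu.1 p).
  by apply: continuous_sum => x.
have l2 p : continuous (fun tu : {ptws T -> R} * {ptws T' -> R} => lower le' tu.2 p).
  by apply: continuous_sum => x.
apply: max_fun_continuous; first exact: (cont_cst (a := 0)).
apply: contB; first by apply: min_fun_continuous; apply: contD.
exact: max_fun_continuous.
Qed.

Lemma within_staircase :
  {within realization_set R P le `*` realization_set R Q le', continuous staircase}.
Proof.
apply: within_ptws => z; apply: contM.
  by apply: continuous_subspaceT; exact: continuous_overlap.
apply: withinV.
  by move=> [t u] [/= Pt Qu]; rewrite gt_eqF//; exact: sum_overlap_gt0.
by apply: continuous_subspaceT; apply: continuous_sum => w; exact: continuous_overlap.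
Qed.

End Product.

Section StraightLine.
Variables (R : realType) (T : finType) (P : {set T}) (le : rel T).

(** Segments stay in the realization because both ends are supported on the chain that supports
    [g x]. *)
Lemma straight_line (X : topologicalType) (A : set X) (f g : X -> {ptws T -> R}) :
  {within A, continuous f} -> {within A, continuous g} ->
  (forall x, A x -> realization_set R P le (f x)) ->
  (forall x, A x -> realization_set R P le (g x)) ->
  (forall x, A x -> supp (f x) \subset supp (g x)) ->
  homotopic_on R A (realization_set R P le) f g.
Proof.
move=> cf cg fP gP fg.
exists (fun z x => (1 - z.1) * f z.2 x + z.1 * g z.2 x); split.
- have c1 : continuous (fun z : R * X => z.1) by move=> z; exact: cvg_fst.
  have aux (k : X -> {ptws T -> R}) : {within A, continuous k} ->
      forall x, {within unit_itv R `*` A, continuous (fun z => k z.2 x)}.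
    move=> ck x; apply: (@within_comp _ _ _ _ setT (fun z : R * X =>
      k z.2) (fun t : {ptws T -> R} => t x)) => //.
      apply: (@within_comp _ _ _ _ A snd k) => //; first by move=> z [].
      by apply: continuous_subspaceT => z; exact: cvg_snd.
    by apply: continuous_subspaceT; exact: ptws_coord_continuous.
  apply: within_ptws => x; apply: contD; apply: contM; try exact: aux.
    apply: continuous_subspaceT; exact: (@contB _ _ (fun=> 1) _ (cont_cst (a := 1)) c1).
  exact: continuous_subspaceT c1.
- move=> s x /andP[s0 s1] Ax; have [f0 fN f1 _] := fP _ Ax; have [g0 gN g1 gc] := gP _ Ax.
  have fgx := fintype.subsetP (fg _ Ax).
  have gt0 y : 0 < (1 - s) * f x y + s * g x y -> 0 < g x y.
    move=> h; rewrite lt_neqAle g0 andbT eq_sym; apply/eqP => gy.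
    move: h; rewrite gy mulr0 addr0 => h.
    have : y \in supp (f x).
      rewrite inE lt_neqAle f0 andbT eq_sym; apply: contraTneq h => ->.
      by rewrite mulr0 ltxx.
    by move/fgx; rewrite inE gy ltxx.
  split => [y|y yP||y y' /= hy hy'].
  + by rewrite addr_ge0// mulr_ge0//= subr_ge0.
  + by rewrite fN// gN// !mulr0 addr0.
  + by rewrite big_split /= -!mulr_sumr f1 g1 !mulr1 subrK.
  + by apply: gc; exact: gt0.
- by move=> x _; apply/funext => y; rewrite /= subr0 mul1r mul0r addr0.
- by move=> x _; apply/funext => y; rewrite /= subrr mul0r mul1r add0r.
Qed.

Lemma homotopic_pair (X Y Z : topologicalType) (A : set X) (B : set Y) (C : set Z)
    (f f' : X -> Y) (g g' : X -> Z) :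
  homotopic_on R A B f f' -> homotopic_on R A C g g' ->
  homotopic_on R A (B `*` C) (fun x => (f x, g x)) (fun x => (f' x, g' x)).
Proof.
move=> [H [cH HB H0 H1]] [K [cK KC K0 K1]]; exists (fun z => (H z, K z)); split.
- exact: within_pair.
- by move=> s x us Ax; split; [exact: HB|exact: KC].
- by move=> x Ax; rewrite H0// K0.
- by move=> x Ax; rewrite H1// K1.
Qed.

End StraightLine.

Section ProductRealization.
Variables (R : realType) (T T' : finType) (P : {set T}) (le : rel T) (Q : {set T'}) (le' :
  rel T').
Hypotheses (Pposet : poset_on P le) (Qposet : poset_on Q le').
Local Notation PQ := (realization_set R (finset.setX P Q) (prod_le le le')).

Lemma poset_prod : poset_on (finset.setX P Q) (prod_le le le').
Proof.
have [Pr Pa Pt] := Pposet; have [Qr Qa Qt] := Qposet; split.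
- by move=> [p q]; rewrite finset.in_setX => /andP[/= pP qQ]; rewrite /prod_le Pr// Qr.
- move=> [p q] [p' q']; rewrite !finset.in_setX /prod_le /= => /andP[pP qQ] /andP[p'P q'Q].
  by move=> /andP[h1 h2] /andP[h3 h4]; rewrite (Pa p p')// (Qa q q').
- move=> [p q] [p' q'] [p2 q2]; rewrite !finset.in_setX /prod_le /=.
  move=> /andP[pP qQ] /andP[p'P q'Q] /andP[p2P q2Q] /andP[h1 h2] /andP[h3 h4].
  by rewrite (Pt p p')// (Qt q q').
Qed.

Lemma hequiv_realization_prod :
  hequiv R PQ (realization_set R P le `*` realization_set R Q le').
Proof.
have [Pr Pa Pt] := Pposet; have [Qr Qa Qt] := Qposet.
have [PQr PQa PQt] := poset_prod.
pose f1 := @map_weights R _ _ (@fst T T'); pose f2 := @map_weights R _ _ (@snd T T').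
have f1P t : PQ t -> realization_set R P le (f1 t).
  apply: realization_map_weights => [[p q]|[p q] [p' q'] _ _].
    by rewrite finset.in_setX => /andP[].
  by move=> /andP[].
have f2P t : PQ t -> realization_set R Q le' (f2 t).
  apply: realization_map_weights => [[p q]|[p q] [p' q'] _ _].
    by rewrite finset.in_setX => /andP[].
  by move=> /andP[].
have cf1 : continuous f1 by exact: continuous_map_weights.
have cf2 : continuous f2 by exact: continuous_map_weights.
pose m := @staircase R T T' le le'.
have cm : {within realization_set R P le `*` realization_set R Q le', continuous m}.
  exact: within_staircase.
have mPQ t u : realization_set R P le t -> realization_set R Q le' u -> PQ (m (t, u)).
  by move=> Pt' Qu; exact: realization_staircase.
have cfs : {within PQ, continuous (fun t => (f1 t, f2 t))}.
  by apply: within_pair; exact: continuous_subspaceT.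
exists (fun t => (f1 t, f2 t)), m; split => //.
- by move=> t tPQ; split; [exact: f1P|exact: f2P].
- by move=> [t u] [? ?]; exact: mPQ.
- pose D z := [set w in finset.setX P Q | prod_le le le' w z]%SET.
  have inD x z : (x \in D z) = (x \in finset.setX P Q) && prod_le le le' x z.
    exact: finset.in_set.
  have Dmono z w : z \in finset.setX P Q -> w \in finset.setX P Q -> prod_le le le' z w ->
    D z \subset D w.
    move=> zP wP zw; apply/fintype.subsetP => x; rewrite !inD => /andP[xP xz].
    by rewrite xP /=; exact: PQt xz zw.
  have Dctr z : z \in finset.setX P Q -> contractible R (realization_set R (D z) (prod_le
    le le')).
    move=> zP; apply: (@cone_contractible R _ (D z) _ z); rewrite ?inD ?zP ?PQr//.
    by move=> x; rewrite inD => /andP[_ ->].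
  apply: (carried_homotopic Dmono Dctr).
  + by move=> z _; apply/fintype.subsetP => x; rewrite inD => /andP[].
  + by apply: within_comp cm => // t tPQ; split; [exact: f1P|exact: f2P].
  + by apply: continuous_subspaceT => x; exact: cvg_id.
  + move=> t PQt'; have [Pt1 Qt1] := (f1P _ PQt', f2P _ PQt').
    apply: realization_restrict (mPQ _ _ Pt1 Qt1) _; apply/fintype.subsetP => z.
    rewrite inE => hz; have [h1 h2 _ _] := overlap_gt0 (staircase_gt0 Pposet Qposet Pt1 Qt1 hz).
    have /supp_map_weights[z1 z1t e1] : z.1 \in supp (f1 t) by rewrite inE.
    have /supp_map_weights[z2 z2t e2] : z.2 \in supp (f2 t) by rewrite inE.
    have tin := fintype.subsetP (realization_supp PQt').
    have [z1P z2P] := (tin _ z1t, tin _ z2t).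
    have [_ _ _ tc] := PQt'; have : 0 < t z1 by move: z1t; rewrite inE.
    have : 0 < t z2 by move: z2t; rewrite inE.
    move=> t2 t1; have zP : z \in finset.setX P Q.
      move: z1P z2P; case: (z) (z1) (z2) e1 e2 => p q [p1 q1] [p2 q2] /= <- <-.
      by rewrite !finset.in_setX => /andP[-> _] /andP[_ ->].
    move: z1P z2P; rewrite [z1]surjective_pairing [z2]surjective_pairing !finset.in_setX.
    move=> /andP[/= ? ?] /andP[/= ? ?].
    (* The coordinates of [z] come from two vertices [z1] and [z2] of one chain, and the larger of
       these dominates [z]. *)
    case/orP: (tc _ _ t1 t2) => /andP[l1 l2]; apply/finset.bigcupP.
      by exists z2 => //; rewrite inD zP /prod_le -e1 -e2 l1 Qr.
    by exists z1 => //; rewrite inD zP /prod_le -e1 -e2 l2 Pr.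
  + move=> t PQt'; apply: realization_restrict (PQt') _; apply/fintype.subsetP => p pt.
    apply/finset.bigcupP; exists p => //;
      have pP := fintype.subsetP (realization_supp PQt') _ pt.
    by rewrite inD pP PQr.
(* Projecting the staircase back meets only vertices of the original supports, so straight lines
   suffice. *)
- have -> : (id : {ptws T -> R} * {ptws T' -> R} -> _) = (fun x => (x.1, x.2)).
    by apply/funext => -[].
  apply: homotopic_pair; apply: straight_line.
  + apply: (@within_comp _ _ _ _ PQ m f1) => //; last exact: continuous_subspaceT cf1.
    by move=> [t u] [? ?]; exact: mPQ.
  + by apply: continuous_subspaceT => z; exact: cvg_fst.
  + by move=> [t u] [? ?]; apply/f1P/mPQ.
  + by move=> z [].
  + move=> [t u] [Pt1 Qt1]; apply/fintype.subsetP => p /supp_map_weights[z].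
    rewrite inE => /(staircase_gt0 Pposet Qposet Pt1 Qt1) => /overlap_gt0[tz _ _ _] <-.
    by rewrite inE.
  + apply: (@within_comp _ _ _ _ PQ m f2) => //; last exact: continuous_subspaceT cf2.
    by move=> [t u] [? ?]; exact: mPQ.
  + by apply: continuous_subspaceT => z; exact: cvg_snd.
  + by move=> [t u] [? ?]; apply/f2P/mPQ.
  + by move=> z [].
  + move=> [t u] [Pt1 Qt1]; apply/fintype.subsetP => p /supp_map_weights[z].
    rewrite inE => /(staircase_gt0 Pposet Qposet Pt1 Qt1) => /overlap_gt0[_ uz _ _] <-.
    by rewrite inE.
Qed.

End ProductRealization.

(** * The circle *)

Section Circle.
Variable R : realType.

(** The order complex is a 4-cycle: the two [(false, _)], which go to (1, 0) and (-1, 0), lie below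
    the two [(true, _)], which go to (0, 1) and (0, -1). *)
Definition square_le : rel (bool * bool) := fun u v => (u == v) || (~~ u.1 && v.1).

Let pos (x : R) := Num.max 0 x.

Let cpos : continuous pos.
Proof. by apply: max_fun_continuous => //; [exact: (cont_cst (a := 0))|move=> x;
  exact: cvg_id]. Qed.

Let to_circle (t : {ptws (bool * bool)%type -> R}) : R * R :=
  (Num.sqrt (t (false, true)) - Num.sqrt (t (false, false)),
   Num.sqrt (t (true, true)) - Num.sqrt (t (true, false))).

Let of_circle (z : R * R) : {ptws (bool * bool)%type -> R} := fun u =>
  let x := if u.1 then z.2 else z.1 in (pos (if u.2 then x else - x)) ^+ 2.

Let sum_square (F : bool * bool -> R) : \sum_u F u =
  F (false, true) + F (false, false) + (F (true, true) + F (true, false)).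
Proof.
rewrite (eq_bigr (fun u => F (u.1, u.2))); last by case.
rewrite -(pair_bigA _ (fun a b => F (a, b))) /= !big_bool /=.
by rewrite addrC (addrC (F (false, true))).
Qed.

Let pos_sum (x : R) : pos x ^+ 2 + pos (- x) ^+ 2 = x ^+ 2.
Proof.
rewrite /pos; case: (leP 0 x) => hx.
  by rewrite max_l ?oppr_le0// expr0n addr0.
by rewrite max_r ?oppr_ge0 ?(ltW hx)// expr0n add0r sqrrN.
Qed.

Let pos_diff (x : R) : pos x - pos (- x) = x.
Proof.
rewrite /pos; case: (leP 0 x) => hx.
  by rewrite max_l ?oppr_le0// subr0.
by rewrite max_r ?oppr_ge0 ?(ltW hx)// opprK add0r.
Qed.

Let pos_ge0 (x : R) : 0 <= pos x. Proof. by rewrite /pos le_max lexx. Qed.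

Let pos_disj (x : R) : 0 < pos x -> 0 < pos (- x) -> False.
Proof. by rewrite /pos !lt_max ltxx /= => ? ?; lra. Qed.

Let sqrt_pos (a b : R) : 0 <= a -> 0 <= b -> a * b = 0 -> pos (Num.sqrt a - Num.sqrt b) ^+
  2 = a.
Proof.
move=> a0 b0 /eqP; rewrite mulf_eq0 /pos => /orP[/eqP ->|/eqP ->].
  by rewrite sqrtr0 sub0r max_l ?expr0n// oppr_le0 sqrtr_ge0.
by rewrite sqrtr0 subr0 max_r ?sqrtr_ge0// sqr_sqrtr.
Qed.

Lemma closed_circle : closed (circle R).
Proof.
apply: (@closed_comp _ _ (fun z : R * R => z.1 ^+ 2 + z.2 ^+ 2) [set 1]); last exact: closed_eq.
move=> z _; move: z; apply: contD; apply: contM => z; by [exact: cvg_fst|exact: cvg_snd].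
Qed.

(* On the circle the squares of the positive and negative parts of the
   coordinates sum to [1]: they are barycentric coordinates in the 4-cycle. *)
Lemma hequiv_square_circle :
  hequiv R (realization_set R [set: bool * bool]%SET square_le) (circle R).
Proof.
have disj t i : realization_set R [set: bool * bool]%SET square_le t -> t (i, true) * t (i,
  false) = 0.
  move=> [t0 _ _ tc]; apply/eqP; rewrite mulf_eq0; apply/negPn; rewrite negb_or.
  apply/negP => /andP[n1 n2].
  have := tc (i, true) (i, false); rewrite !lt_neqAle !t0 !andbT ![0 == _]eq_sym n1 n2.
  by move=> /(_ isT isT); rewrite /square_le; case: i {n1 n2}.
exists to_circle, of_circle; split.
- split.
    have cs u : continuous (fun t : {ptws (bool * bool)%type -> R} => Num.sqrt (t u)).
      move=> t; apply: (@continuous_comp _ _ _ (fun t : {ptws (bool * bool)%type -> R} =>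
        t u) Num.sqrt).
        exact: ptws_coord_continuous.
      exact: sqrt_continuous.
    by apply: within_pair; apply: continuous_subspaceT; exact: contB.
  apply: within_ptws => -[a b]; apply: continuous_subspaceT.
  have c1 : continuous (fun z : R * R => if a then z.2 else z.1).
    by case: a => z; [exact: cvg_snd|exact: cvg_fst].
  have c2 : continuous (fun z : R * R =>
    if b then (if a then z.2 else z.1) else - (if a then z.2 else z.1)).
    by case: b => // z; apply: cvgN; exact: c1.
  have c3 : continuous (fun z : R * R =>
    pos (if b then (if a then z.2 else z.1) else - (if a then z.2 else z.1))).
    by move=> z; apply: (@continuous_comp _ _ _ _ pos); [exact: c2|exact: cpos].
  by apply: (@contM _ _ (fun z : R * R =>
    pos (if b then (if a then z.2 else z.1) else - (if a then z.2 else z.1)))); exact: c3.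
- move=> t Pt; have [t0 _ t1 _] := Pt; rewrite /circle /to_circle /=.
  have sq i : (Num.sqrt (t (i, true)) - Num.sqrt (t (i, false))) ^+ 2 = t (i, true) + t (i,
    false).
    rewrite sqrrB -sqrtrM// disj// sqrtr0 mul0rn subr0 !sqr_sqrtr//.
  by rewrite !sq -t1 sum_square.
- move=> z; rewrite /circle /of_circle /= => z1; split => [u|u|| [i b] [j c]].
  + exact: sqr_ge0.
  + by rewrite inE.
  + by rewrite sum_square /= !pos_sum.
  + rewrite /= => h1 h2; rewrite /square_le /=.
    have p x : 0 < pos x ^+ 2 -> 0 < pos x by rewrite !lt_neqAle pos_ge0 andbT eq_sym
      sqrf_eq0 eq_sym => /andP[].
    move: h1 h2; case: i; case: j => /p h1 /p h2; rewrite ?orbT// ?andbF ?orbF;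
      by case: b h1; case: c h2 => h2 h1 //; case: (pos_disj h1 h2) || case: (pos_disj h2 h1).
(* The two maps are inverse to each other, so constant homotopies do. *)
- exists snd; split => //; first by apply: continuous_subspaceT => z; exact: cvg_snd.
  move=> t Pt /=; apply/funext => -[i b]; rewrite /of_circle /to_circle /=.
  have [t0 _ _ _] := Pt; have d := disj _ i Pt.
  by case: i d; case: b => d; rewrite ?opprB sqrt_pos// mulrC.
- exists snd; split => //; first by apply: continuous_subspaceT => z; exact: cvg_snd.
  move=> [x y] z1 /=; rewrite /of_circle /to_circle /=.
  by rewrite !sqrtr_sqr !ger0_norm ?pos_ge0// !pos_diff.
Qed.

End Circle.

(** The last clause is the universal property of the subspace topology. Unlike an equality with a
    subspace type, this description is stable under products. *)
Definition embeds (S X : topologicalType) (iota : S -> X) (A : set X) : Prop :=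
  [/\ continuous iota, forall s, A (iota s), forall x, A x -> exists s, iota s = x,
      injective iota &
      forall (W : topologicalType) (k : W -> S), continuous (iota \o k) -> continuous k].

Lemma embeds_set_type (X : topologicalType) (A : set X) : embeds (@set_val X A) A.
Proof.
split.
- exact: initial_continuous.
- by move=> [x xA]; exact: set_mem xA.
- by move=> x /mem_set xA; exists (exist _ x xA).
- by move=> [x xA] [y yA] /= xy; apply: eq_exist.
- by move=> W k; exact: continuous_comp_initial.
Qed.

Lemma embeds_prod (S X S' X' : topologicalType) (iota : S -> X) (A : set X)
    (iota' : S' -> X') (A' : set X') : embeds iota A -> embeds iota' A' ->
  embeds (fun s => (iota s.1, iota' s.2)) (A `*` A').
Proof.
move=> [ci iA iS ii iI] [ci' iA' iS' ii' iI']; split.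
- move=> z; apply: cvg_pair.
    by apply: (@continuous_comp _ _ _ fst iota); [exact: cvg_fst|exact: ci].
  by apply: (@continuous_comp _ _ _ snd iota'); [exact: cvg_snd|exact: ci'].
- by move=> z; split; [exact: iA|exact: iA'].
- by move=> [x y] [/= /iS[s <-] /iS'[s' <-]]; exists (s, s').
- by move=> [s s'] [t t'] /= [/ii -> /ii' ->].
- move=> W k ck.
  have c1 : continuous (fst \o k).
    apply: iI => w; apply: (@continuous_comp _ _ _ (fun w =>
      (iota (k w).1, iota' (k w).2)) fst).
      exact: ck.
    exact: cvg_fst.
  have c2 : continuous (snd \o k).
    apply: iI' => w; apply: (@continuous_comp _ _ _ (fun w =>
      (iota (k w).1, iota' (k w).2)) snd).
      exact: ck.
    exact: cvg_snd.
  have -> : k = (fun w => ((fst \o k) w, (snd \o k) w)).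
    by apply/funext => w /=; case: (k w).
  by move=> w; apply: cvg_pair; [exact: c1|exact: c2].
Qed.

(** * From subsets to subspace types *)

Section Transfer.
Variable R : realType.

Lemma continuous_within_comp (S X Y : topologicalType) (A : set X) (f : S -> X) (g : X -> Y) :
  continuous f -> (forall s, A (f s)) -> {within A, continuous g} -> continuous (g \o f).
Proof.
move=> cf fA cg; apply/continuous_subspace_setT.
by apply: (@within_comp _ _ _ setT A f g) => //; exact: continuous_subspaceT.
Qed.

Lemma embeds_homotopic (S X : topologicalType) (iota : S -> X) (A : set X) (k : X -> X) (k'
  : S -> S) :
  embeds iota A -> (forall s, iota (k' s) = k (iota s)) ->
  homotopic_on R A A k id -> homotopic R k' id.
Proof.
move=> [ci iA iS ii iI] kk [H [cH HA H0 H1]].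
(* Outside the unit interval [H] may leave [A]; the lift is then an arbitrary point, here [z.2]. *)
have lift (z : R * S) : {s' : S | unit_itv R z.1 -> iota s' = H (z.1, iota z.2)}.
  apply: cid; case: (pselect (unit_itv R z.1)) => [u|nu]; last by exists z.2.
  by have [s' <-] := iS _ (HA _ _ u (iA z.2)); exists s'.
exists (fun z => sval (lift z)); split.
- apply: (@iI (subspace _) (from_subspace _ (fun z => sval (lift z)))).
  apply: (@within_eq _ _ _ (fun z : R * S => H (z.1, iota z.2))).
    move=> [s x] [/= us _]; rewrite (svalP (lift (s, x)))//.
  apply: (@within_comp _ _ _ _ (unit_itv R `*` A) (fun z : R * S => (z.1, iota z.2)) H) => //.
    by move=> [s x] [/= us _]; split => //=; move: us; rewrite in_itv.
  apply: within_pair; apply: continuous_subspaceT => z; first exact: cvg_fst.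
  by apply: (@continuous_comp _ _ _ snd iota); [exact: cvg_snd|exact: ci].
- move=> s; apply: ii; rewrite (svalP (lift (0, s))) /=;
  last by rewrite /unit_itv /= lexx ler01.
  by rewrite H0.
- move=> s; apply: ii; rewrite (svalP (lift (1, s))) /=;
  last by rewrite /unit_itv /= lexx ler01.
  by rewrite H1.
Qed.

Lemma hequiv_embeds (S X S' X' : topologicalType) (iota : S -> X) (A : set X)
    (iota' : S' -> X') (A' : set X') : embeds iota A -> embeds iota' A' ->
  hequiv R A A' -> homotopy_equivalent R S S'.
Proof.
move=> eA eA' [f [g [[cf cg] fA gA hA hA']]].
have [ci iA iS ii iI] := eA; have [ci' iA' iS' ii' iI'] := eA'.
have lift s : {s' : S' | iota' s' = f (iota s)} by apply/cid/iS'/fA/iA.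
have lift' s' : {s : S | iota s = g (iota' s')} by apply/cid/iS/gA/iA'.
exists (fun s => sval (lift s)), (fun s => sval (lift' s)); split.
- apply: iI'; have -> : iota' \o (fun s => sval (lift s)) = f \o iota.
    by apply/funext => s /=; rewrite (svalP (lift s)).
  exact: continuous_within_comp cf.
- apply: iI; have -> : iota \o (fun s => sval (lift' s)) = g \o iota'.
    by apply/funext => s /=; rewrite (svalP (lift' s)).
  exact: continuous_within_comp cg.
- apply: embeds_homotopic eA _ hA => s /=.
  by rewrite (svalP (lift' _)) (svalP (lift _)).
- apply: embeds_homotopic eA' _ hA' => s /=.
  by rewrite (svalP (lift _)) (svalP (lift' _)).
Qed.

End Transfer.

Lemma quillen_up (R : realType) (T T' : finType) (P : {set T}) (le : rel T)
    (P' : {set T'}) (le' : rel T') (phi : T -> T') :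
  (forall p, p \in P -> phi p \in P') ->
  (forall p q, p \in P -> q \in P -> le p q -> le' (phi p) (phi q)) ->
  (forall q, q \in P' -> le' q q) ->
  (forall a b c, a \in P' -> b \in P' -> c \in P' -> le' a b -> le' b c -> le' a c) ->
  (forall q, q \in P' ->
    contractible R (realization_set R [set p in P | le' q (phi p)]%SET le)) ->
  hequiv R (realization_set R P le) (realization_set R P' le').
Proof.
move=> phiP mono refl' trans' ctr.
rewrite -(realization_flip R P le) -(realization_flip R P' le').
apply: (@quillen R _ _ _ _ _ _ phi) => //.
- by move=> p q pP qP qp; exact: mono.
- by move=> a b c aP bP cP ba cb; exact: trans' cb ba.
- by move=> q qP; rewrite realization_flip; exact: ctr.
Qed.

(** * Sign vectors closed under elimination *)

Section SignVectors.
Variable I : finType.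
Implicit Types (X Y Z : signvec I).

Lemma sv_leP X Y : reflect (forall f, sign_le (X f) (Y f)) (sv_le X Y).
Proof. exact: forallP. Qed.

Lemma sign_le_refl a : sign_le a a.
Proof. by rewrite /sign_le eqxx orbT. Qed.

Lemma sign_le_trans : transitive sign_le.
Proof. by move=> [[]|] [[]|] [[]|]. Qed.

Lemma sign_le_anti : antisymmetric sign_le.
Proof. by move=> [[]|] [[]|]. Qed.

Lemma sv_le_refl X : sv_le X X.
Proof. by apply/sv_leP => f; exact: sign_le_refl. Qed.

Lemma sv_le_trans : transitive (@sv_le I).
Proof.
by move=> Y X Z /sv_leP XY /sv_leP YZ; apply/sv_leP => f; exact: sign_le_trans (XY f) (YZ f).
Qed.

Lemma sv_le_anti X Y : sv_le X Y -> sv_le Y X -> X = Y.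
Proof.
by move=> /sv_leP XY /sv_leP YX; apply/ffunP => f; apply: sign_le_anti; rewrite XY YX.
Qed.

Lemma sv_le_composel X Y : sv_le X (compose X Y).
Proof. by apply/sv_leP => f; rewrite ffunE; case: eqP => [->//|_]; exact: sign_le_refl. Qed.

Definition elimination_closed (L : {set signvec I}) :=
  (forall X Y, X \in L -> Y \in L -> compose X Y \in L) /\
  (forall X Y e, X \in L -> Y \in L -> sep X Y e ->
    exists2 Z, Z \in L & Z e = s0 /\ (forall f, ~~ sep X Y f -> Z f = compose X Y f)).

(** Deletion keeps the ground set and only erases the entry, so that the induction stays within one
    type. *)
Definition delete (f : I) X : signvec I := [ffun g => if g == f then s0 else X g].

Lemma delete_closed f (L : {set signvec I}) :
  elimination_closed L -> elimination_closed (delete f @: L).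
Proof.
move=> [Lc Le]; split => [_ _ /imsetP[X XL ->] /imsetP[Y YL ->]|].
  apply/imsetP; exists (compose X Y); first exact: Lc.
  by apply/ffunP => g; rewrite !ffunE; case: (g == f).
move=> _ _ e /imsetP[X XL ->] /imsetP[Y YL ->].
rewrite /sep !ffunE; case: (e =P f) => [//|ef] sXY.
have [Z ZL [Ze Zf]] := Le _ _ _ XL YL sXY; exists (delete f Z); first exact: imset_f.
split=> [|g]; first by rewrite ffunE; case: ifP.
by rewrite !ffunE; case: ifP => // gf /Zf ->; rewrite ffunE.
Qed.

Lemma delete_le f X : sv_le (delete f X) X.
Proof. by apply/sv_leP => g; rewrite ffunE; case: ifP => // _; exact: sign_le_refl. Qed.

Lemma delete_mono f X Y : sv_le X Y -> sv_le (delete f X) (delete f Y).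
Proof. by move=> /sv_leP XY; apply/sv_leP => g; rewrite !ffunE; case: ifP. Qed.

Variable R : realType.
Local Notation ctr A := (contractible R (realization_set R A (@sv_le I))).

(* If the sign [s] of [X'] at [f] is nonzero, the fibre contracts in two steps:
   sign [- s] at [f] is lowered to [0] by elimination against [X'], then [0] is
   raised to [s] by composition with [X']. *)
Lemma delete_fibre (L : {set signvec I}) f X' : elimination_closed L -> X' \in L ->
  ctr [set Y in L | sv_le (delete f X') (delete f Y)]%SET.
Proof.
move=> [Lc Le] X'L; set P := [set Y in L | _]%SET.
have inP Y : (Y \in P) = (Y \in L) && sv_le (delete f X') (delete f Y) by exact: finset.in_set.
have leE Y g : Y \in P -> g != f -> sign_le (X' g) (Y g).
  by rewrite inP => /andP[_ /sv_leP /(_ g)]; rewrite !ffunE => + /negbTE gf; rewrite gf.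
have PI Y : Y \in L -> (forall g, g != f -> sign_le (X' g) (Y g)) -> Y \in P.
  move=> YL h; rewrite inP YL; apply/sv_leP => g; rewrite !ffunE.
  by case: eqVneq => // gf; exact: h.
have X'P : X' \in P by apply: PI => // g _; exact: sign_le_refl.
have refl (Y : signvec I) : sv_le Y Y := sv_le_refl Y.
case: (X' f =P s0) => [X'f|/eqP X'f].
  apply: (@cone_contractible R _ _ _ X') => // Y YP; apply/orP; right; apply/sv_leP => g.
  by case: (eqVneq g f) => [->|gf]; [rewrite X'f|exact: leE].
pose P1 := [set Y in P | sign_le (Y f) (X' f)]%SET.
pose P2 := [set Y in P | Y f == X' f]%SET.
have inP1 Y : (Y \in P1) = (Y \in P) && sign_le (Y f) (X' f) by exact: finset.in_set.
have inP2 Y : (Y \in P2) = (Y \in P) && (Y f == X' f) by exact: finset.in_set.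
have trans (A : {set signvec I}) (a b c : signvec I) : a \in A -> b \in A -> c \in A ->
  sv_le a b -> sv_le b c -> sv_le a c.
  by move=> _ _ _; exact: sv_le_trans.
have c2 : ctr P2.
  apply: (@cone_contractible R _ _ _ X') => //; first by rewrite inP2 X'P /=.
  move=> Y; rewrite inP2 => /andP[YP /eqP Yf]; apply/orP; right; apply/sv_leP => g.
  by case: (eqVneq g f) => [->|gf]; [rewrite Yf sign_le_refl|exact: leE].
have c1 : ctr P1.
  apply: contractible_hequiv c2; first exact: closed_realization.
  apply: hequiv_sym; apply: (quillen_up (phi := id)) => //.
  - by move=> Y; rewrite inP2 inP1 => /andP[-> /eqP ->]; exact: sign_le_refl.
  - exact: trans.
  move=> Y; rewrite inP1 => /andP[YP Yf].
  have YL : Y \in L by move: YP; rewrite inP => /andP[].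
  have cE g : g != f -> compose X' Y g = Y g.
    by move=> gf; have := leE _ _ YP gf; rewrite ffunE /sign_le; case: ifP => // _ /eqP.
  have cf : compose X' Y f = X' f by rewrite ffunE (negbTE X'f).
  apply: (@cone_contractible R _ _ _ (compose X' Y)) => //.
    rewrite finset.in_set inP2 cf eqxx andbT PI ?Lc//=; last by move=> g gf; rewrite cE//;
      exact: leE.
    by apply/sv_leP => g; case: (eqVneq g f) => [->|gf]; rewrite ?cf ?cE// sign_le_refl.
  move=> Z; rewrite finset.in_set inP2 => /andP[/andP[ZP /eqP Zf] /sv_leP YZ].
  apply/orP; right; apply/sv_leP => g.
  by case: (eqVneq g f) => [->|gf]; rewrite ?cf ?Zf ?sign_le_refl// cE.
apply: contractible_hequiv c1; first exact: closed_realization.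
apply: hequiv_sym; apply: (quillen (phi := id)) => //.
- by move=> Y; rewrite inP1 => /andP[].
- exact: trans.
move=> Y YP; have YL : Y \in L by move: YP; rewrite inP => /andP[].
case: (boolP (sign_le (Y f) (X' f))) => Yf.
  apply: (@cone_contractible R _ _ _ Y) => //; first by rewrite finset.in_set inP1 YP Yf refl.
  by move=> Z; rewrite finset.in_set => /andP[_ ->].
have sf : sep X' Y f.
  by move: X'f Yf; rewrite /sep; case: (X' f) => [[]|]; case: (Y f) => [[]|].
have [Z ZL [Zf Zg]] := Le _ _ _ X'L YL sf.
(* Away from [f], [Y] extends [X'], so nothing else is separated and the result of the elimination
   is forced. *)
have ZE : Z = delete f Y.
  apply/ffunP => g; rewrite [RHS]ffunE; case: eqVneq => [->//|gf].
  have := leE _ _ YP gf => h; rewrite Zg ?ffunE /sep.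
    by move: h; rewrite /sign_le; case: ifP => // _ /eqP.
  by move: h; case: (X' g) => [[]|]; case: (Y g) => [[]|].
have Yg g : g != f -> delete f Y g = Y g by move=> /negbTE gf; rewrite ffunE gf.
have Yf0 : delete f Y f = s0 by rewrite ffunE eqxx.
apply: (@cone_contractible R _ _ _ (delete f Y)) => //.
  rewrite finset.in_set inP1 delete_le Yf0 !andbT; apply: PI; first by rewrite -ZE.
  by move=> g gf; rewrite Yg//; exact: leE.
move=> W; rewrite finset.in_set inP1 => /andP[/andP[WP Wf] /sv_leP WY].
apply/orP; left; apply/sv_leP => g.
case: (eqVneq g f) => [->|gf]; last by rewrite Yg.
rewrite Yf0; have := WY f; move: Wf Yf X'f.
by case: (W f) => [[]|]; case: (Y f) => [[]|]; case: (X' f) => [[]|].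
Qed.

(* Coordinates are deleted one by one, down to a single vector. *)
Lemma elimination_closed_contractible (L : {set signvec I}) X0 :
  elimination_closed L -> X0 \in L -> ctr L.
Proof.
suff H n (D : {set I}) : #|D| = n -> forall (L : {set signvec I}) X0,
    (forall X f, X \in L -> f \notin D -> X f = s0) ->
    elimination_closed L -> X0 \in L -> ctr L.
  by apply: (H _ [set: I]%SET (erefl _)) => X f _; rewrite inE.
elim: n D => [|n IH] D cD L0 X1 LD Lc XL.
  have D0 f : f \notin D by move/eqP: cD; rewrite cards_eq0 => /eqP ->; rewrite inE.
  apply: (@cone_contractible R _ _ _ X1) => //; first exact: sv_le_refl.
  by move=> X X'L; rewrite (_ : X = X1) ?sv_le_refl//; apply/ffunP => f; rewrite !LD.
have /card_gt0P[f fD] : (0 < #|D|)%N by rewrite cD.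
have cD' : #|D :\ f| = n by move: cD; rewrite (cardsD1 f) fD => -[].
have c' : ctr (delete f @: L0).
  apply: (IH _ cD' _ (delete f X1)); [|exact: delete_closed|exact: imset_f].
  move=> _ g /imsetP[X X'L ->]; rewrite !inE negb_and negbK ffunE.
  by case: eqVneq => //= _; exact: LD.
apply: contractible_hequiv c'; first exact: closed_realization.
apply: (quillen_up (phi := delete f)).
- by move=> X X'L; exact: imset_f.
- by move=> X Y _ _; exact: delete_mono.
- by move=> X _; exact: sv_le_refl.
- by move=> X Y Z _ _ _; exact: sv_le_trans.
by move=> _ /imsetP[X X'L ->]; exact: delete_fibre.
Qed.

End SignVectors.

Section CoordinateFilters.
Variable I : finType.

Definition filter_coords (L : {set signvec I}) (K : I -> pred sign) : {set signvec I} :=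
  [set X in L | [forall f, K f (X f)]]%SET.

Lemma mem_filter_coords (L : {set signvec I}) (K : I -> pred sign) X :
  reflect (X \in L /\ forall f, K f (X f)) (X \in filter_coords L K).
Proof.
rewrite finset.in_set; apply: (iffP andP) => -[XL /forallP XK]; split => //.
Qed.

(** Elimination departs from the composition only at separated coordinates. There both + and - are
    allowed, hence also 0, and the condition is void. *)
Lemma filter_coords_closed (L : {set signvec I}) (K : I -> pred sign) :
  elimination_closed L -> (forall f, K f splus -> K f sminus -> K f s0) ->
  elimination_closed (filter_coords L K).
Proof.
move=> [Lc Le] K0; split => [X Y|X Y e] /mem_filter_coords[XL XK] /mem_filter_coords[YL YK].
  apply/mem_filter_coords; split => [|f]; first exact: Lc.
  by rewrite ffunE; case: ifP.
move=> sXY; have [Z ZL [Ze Zf]] := Le _ _ _ XL YL sXY; exists Z => //.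
apply/mem_filter_coords; split => // f.
case: (boolP (sep X Y f)) => [|/Zf ->]; last by rewrite ffunE; case: ifP.
move: (XK f) (YK f) (K0 f); rewrite /sep.
by case: (X f) => [[]|]; case: (Y f) => [[]|]; case: (Z f) => [[]|] //= h1 h2 h3 _; exact: h3.
Qed.

Lemma compose_absorb (X F Y : signvec I) : sv_le X F -> compose F (compose X Y) = compose F Y.
Proof.
move=> /sv_leP XF; apply/ffunP => f; rewrite !ffunE; case: eqP => // Ff.
by have := XF f; rewrite Ff; case: (X f) => [[]|].
Qed.

End CoordinateFilters.

(** * Signs of complex numbers *)

Section SignPairs.
Implicit Types p q a b : sign * sign.

Definition le2 : rel (sign * sign) := fun p q => sign_le p.1 q.1 && sign_le p.2 q.2.

Lemma le2_refl p : le2 p p.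
Proof. by rewrite /le2 !sign_le_refl. Qed.

Lemma le2_trans q p p' : le2 p q -> le2 q p' -> le2 p p'.
Proof.
by move=> /andP[h1 h2] /andP[h3 h4]; rewrite /le2 (sign_le_trans h1 h3) (sign_le_trans h2 h4).
Qed.

Lemma le2_anti p q : le2 p q -> le2 q p -> p = q.
Proof.
case: p q => [x y] [x' y'] /andP[/= h1 h2] /andP[/= h3 h4].
by congr pair; apply: sign_le_anti; apply/andP.
Qed.

(* [a] is the ray through i^k, or the open quadrant between the rays through i^k
   and i^(k+1); [turn a] is multiplication by i^k and [unturn a] its inverse. *)
Definition unturn a p : sign * sign :=
  match a with
  | (None, Some true) | (Some false, Some true) => (p.2, sneg p.1)
  | (Some false, None) | (Some false, Some false) => (sneg p.1, sneg p.2)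
  | (None, Some false) | (Some true, Some false) => (sneg p.2, p.1)
  | _ => p
  end.

Definition turn a p : sign * sign :=
  match a with
  | (None, Some true) | (Some false, Some true) => (sneg p.2, p.1)
  | (Some false, None) | (Some false, Some false) => (sneg p.1, sneg p.2)
  | (None, Some false) | (Some true, Some false) => (p.2, sneg p.1)
  | _ => p
  end.

Lemma snegK : involutive sneg.
Proof. by case=> [[]|]. Qed.

Lemma unturnK a : cancel (unturn a) (turn a).
Proof. by case: a => [[[]|] [[]|]] [x y]; rewrite /= ?snegK. Qed.

Lemma turnK a : cancel (turn a) (unturn a).
Proof. by case: a => [[[]|] [[]|]] [x y]; rewrite /= ?snegK. Qed.

Lemma sneg_le (x y : sign) : sign_le x y -> sign_le (sneg x) (sneg y).
Proof. by case: x y => [[]|] [[]|]. Qed.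

Lemma unturn_mono a p q : le2 p q -> le2 (unturn a p) (unturn a q).
Proof.
by case: p q => [x y] [x' y'] /andP[/= h1 h2]; case: a => [[[]|] [[]|]];
  rewrite /le2 /= ?h1 ?h2 ?sneg_le.
Qed.

Lemma turn_mono a p q : le2 p q -> le2 (turn a p) (turn a q).
Proof.
by case: p q => [x y] [x' y'] /andP[/= h1 h2]; case: a => [[[]|] [[]|]];
  rewrite /le2 /= ?h1 ?h2 ?sneg_le.
Qed.

Lemma turn_eq0 a p : (turn a p == (s0, s0)) = (p == (s0, s0)).
Proof. by case: a p => [[[]|] [[]|]] [[[]|] [[]|]]. Qed.

Definition quadrant a := (a.1 != s0) && (a.2 != s0).

(* For [p = (x, y)] nonzero, [sector q p] says that the cell [p] lies in the closure
   of the region swept by the cell [q] when it turns clockwise by a right angle: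
   the real part of [q] is the sign of x - y, or the imaginary part of [q] is the
   sign of x + y, in both cases provided that [p] determines this sign. *)
Definition sector_re (p : sign * sign) : pred sign :=
  fun x => sign_le p.1 x && sign_le (sneg p.2) x.

Definition sector_im (p : sign * sign) : pred sign :=
  fun y => sign_le p.1 y && sign_le p.2 y.

Definition sector q p := sector_re p q.1 || sector_im p q.2.

Definition swept a q p := if quadrant a then sector (unturn a q) p else le2 p (unturn a q).

Lemma sector_re_mono p p' x x' : le2 p' p -> sign_le x x' -> sector_re p x -> sector_re p' x'.
Proof.
move=> /andP[p1 p2] xx /andP[h1 h2]; rewrite /sector_re.
by rewrite (sign_le_trans p1 (sign_le_trans h1 xx)) (sign_le_trans (sneg_le p2)
  (sign_le_trans h2 xx)).
Qed.

Lemma sector_im_mono p p' x x' : le2 p' p -> sign_le x x' -> sector_im p x -> sector_im p' x'.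
Proof.
move=> /andP[p1 p2] xx /andP[h1 h2]; rewrite /sector_im.
by rewrite (sign_le_trans p1 (sign_le_trans h1 xx)) (sign_le_trans p2 (sign_le_trans h2 xx)).
Qed.

Lemma swept_mono a q q' p p' : le2 q q' -> le2 p' p -> swept a q p -> swept a q' p'.
Proof.
move=> qq pp; have /andP[u1 u2] := unturn_mono a qq; rewrite /swept; case: ifP => _.
  by case/orP => h; apply/orP; [left; exact: sector_re_mono h|right; exact: sector_im_mono h].
by move=> h; apply: le2_trans pp (le2_trans h _); rewrite /le2 u1.
Qed.

(** The rays bounding a quadrant are the start and the end of its right-angle turn, so the exact
    rotations on them are instances of the swept relation. The pair (0, 0) lies below every arc
    without being one. *)
Lemma swept_arc a b q p : a != (s0, s0) -> le2 a b -> swept a q p -> swept b q p.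
Proof.
by case: a => [[[]|] [[]|]]; case: b => [[[]|] [[]|]] //= _ _;
  case: q => [[[]|] [[]|]]; case: p => [[[]|] [[]|]].
Qed.

Lemma unturn_ray a q : ~~ quadrant a -> q != (s0, s0) -> le2 q a -> unturn a q = (splus, s0).
Proof. by case: a => [[[]|] [[]|]] //=; case: q => [[[]|] [[]|]]. Qed.

Lemma turn_ray a : ~~ quadrant a -> a != (s0, s0) -> turn a (splus, s0) = a.
Proof. by case: a => [[[]|] [[]|]]. Qed.

Lemma unturn_quadrant a q : quadrant a -> le2 q a = le2 (unturn a q) (splus, splus).
Proof. by case: a => [[[]|] [[]|]] //=; case: q => [[[]|] [[]|]]. Qed.

Definition compose2 p q : sign * sign :=
  (if p.1 == s0 then q.1 else p.1, if p.2 == s0 then q.2 else p.2).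

(* Elimination leaves the value at separated coordinates unspecified, so [K]
   must accept every [r] that agrees with the composition elsewhere. *)
Definition pair_stable (K : pred (sign * sign)) := forall p q r,
  K p -> K q ->
  ((p.1 == s0) || (q.1 != sneg p.1) -> r.1 = (compose2 p q).1) ->
  ((p.2 == s0) || (q.2 != sneg p.2) -> r.2 = (compose2 p q).2) -> K r.

Lemma pair_stableI (K K' : pred (sign * sign)) : pair_stable K -> pair_stable K' ->
  pair_stable (fun p => K p && K' p).
Proof.
move=> h h' p q r /andP[p1 p2] /andP[q1 q2] r1 r2.
by apply/andP; split; [exact: h p1 q1 r1 r2|exact: h' p2 q2 r1 r2].
Qed.

Lemma pair_stable_eq p0 : p0 = (splus, s0) -> pair_stable (pred1 p0).
Proof. by move=> -> p q [x y] /eqP -> /eqP -> /= /(_ isT) -> /(_ isT) ->. Qed.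

Lemma pair_stable_ge p0 : pair_stable (le2 p0).
Proof.
case: p0 => a b [a1 b1] [a2 b2] [a3 b3] /andP[/= h1 h2] /andP[/= h3 h4] h5 h6.
apply/andP; split => /=.
  by move: h1 h3 h5; case: a a1 a2 a3 => [[]|] [[]|] [[]|] [[]|] //= _ _ /(_ isT).
by move: h2 h4 h6; case: b b1 b2 b3 => [[]|] [[]|] [[]|] [[]|] //= _ _ /(_ isT).
Qed.

(** For [q] in a quadrant, [sector q] is a closed half-plane, which is no longer convex without the
    origin; the extra conditions cut it down to the open half-plane. For [q] on a half-axis it is a
    closed quadrant, and nothing changes. *)
Definition open_sector q p := [&& sector q p,
  (q.1 != s0) && (q.2 == q.1) ==> (p.1 == q.1) &
  (q.1 != s0) && (q.2 == sneg q.1) ==> (p.2 == q.2)].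

(** [b] will say that the element is live, where 0 is forbidden. An open half-plane and a closed
    quadrant without its vertex are both convex. *)
Lemma pair_stable_open_sector (b : bool) q : (b -> q != (s0, s0)) ->
  pair_stable (fun p => open_sector q p && (b ==> (p != (s0, s0)))).
Proof.
move=> qb [x y] [x' y'] [x2 y2]; move: qb.
case: b => [/(_ isT)|_]; rewrite ?andbT.
  by case: q => [[[]|] [[]|]] // _; case: x => [[]|]; case: y => [[]|] //=;
     case: x' => [[]|]; case: y' => [[]|] //= _ _ h1 h2;
     move: h1 h2; case: x2 => [[]|]; case: y2 => [[]|] //= h1 h2;
       do ?[by have := h1 isT|by have := h2 isT].
by case: q => [[[]|] [[]|]]; case: x => [[]|]; case: y => [[]|] //=;
     case: x' => [[]|]; case: y' => [[]|] //= _ _ h1 h2;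
     move: h1 h2; case: x2 => [[]|]; case: y2 => [[]|] //= h1 h2;
       do ?[by have := h1 isT|by have := h2 isT].
Qed.

(** Composition is a small displacement of [p] towards [p0]; moved towards an interior point, a
    boundary point of a closed half-plane becomes interior. *)
Lemma open_sector_compose q p p0 : sector q p -> open_sector q p0 -> open_sector q
  (compose2 p p0).
Proof.
by case: q => [[[]|] [[]|]]; case: p => [[[]|] [[]|]] //=; case: p0 => [[[]|] [[]|]].
Qed.

End SignPairs.

(** * The complexified oriented matroid *)

Section Matroid.
Variables (R : realType) (E : finType) (L : {set signvec E}) (e : E).
Hypothesis OM : is_OM_covectors L.
Hypothesis loopless_e : exists2 X, X \in L & X e != s0.

Local Notation csv := (signvec (E + E)%type).
Implicit Types (n m : csv) (X Y F C : signvec E) (a : sign * sign).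

(** A pair of sign vectors is encoded as one sign vector on [E + E], so that the contractibility of
    sets closed under elimination applies to pairs. *)
Definition re n : signvec E := [ffun f => n (inl f)].
Definition im n : signvec E := [ffun f => n (inr f)].
Definition at_ n f : sign * sign := (n (inl f), n (inr f)).
Definition cvec (u : E -> sign * sign) : csv :=
  [ffun i => match i with inl f => (u f).1 | inr f => (u f).2 end].

Lemma at_cvec u f : at_ (cvec u) f = u f.
Proof. by rewrite /at_ !ffunE; case: (u f). Qed.

Lemma re_cvec X Y : re (cvec (fun f => (X f, Y f))) = X.
Proof. by apply/ffunP => f; rewrite !ffunE. Qed.

Lemma im_cvec X Y : im (cvec (fun f => (X f, Y f))) = Y.
Proof. by apply/ffunP => f; rewrite !ffunE. Qed.

Lemma at_inj n m : (forall f, at_ n f = at_ m f) -> n = m.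
Proof. by move=> h; apply/ffunP => -[f|f]; have [] := h f. Qed.

Lemma at_leP n m : reflect (forall f, le2 (at_ n f) (at_ m f)) (sv_le n m).
Proof.
apply: (iffP (sv_leP _ _)) => h.
  by move=> f; rewrite /le2 (h (inl f)) (h (inr f)).
by move=> [f|f]; have /andP[] := h f.
Qed.

Lemma le_re n m : sv_le n m -> sv_le (re n) (re m).
Proof. by move=> /sv_leP h; apply/sv_leP => f; rewrite !ffunE. Qed.

Lemma le_im n m : sv_le n m -> sv_le (im n) (im m).
Proof. by move=> /sv_leP h; apply/sv_leP => f; rewrite !ffunE. Qed.

(* The matroid may have loops, on which every covector vanishes. *)
Definition live f := [exists X in L, X f != s0].

Lemma dead X f : X \in L -> ~~ live f -> X f = s0.
Proof. by move=> XL; rewrite negb_exists => /forallP /(_ X); rewrite XL /= negbK => /eqP. Qed.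

Lemma live_e : live e.
Proof. by have [X XL Xe] := loopless_e; apply/existsP; exists X; rewrite XL. Qed.

Lemma OM_elimination_closed : elimination_closed L.
Proof. by have [_ _ Lc Le] := OM. Qed.

Lemma L_neg X : X \in L -> sv_neg X \in L.
Proof. by have [_ h _ _] := OM; exact: h. Qed.

Lemma L_compose X Y : X \in L -> Y \in L -> compose X Y \in L.
Proof. by have [h _] := OM_elimination_closed; exact: h. Qed.

Lemma topesP C : reflect (C \in L /\ forall f, live f -> C f != s0) (C \in topes L).
Proof.
rewrite finset.in_set; apply: (iffP andP) => -[CL].
  move=> /forall_inP h; split => // f /existsP[X /andP[XL Xf]].
  have /eqP <- := implyP (h _ (L_compose CL XL)) (sv_le_composel _ _).
  by rewrite ffunE; case: ifP => // /negbT.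
move=> h; split => //; apply/forall_inP => X XL; apply/implyP => /sv_leP CX.
apply/eqP/ffunP => f; case: (boolP (live f)) => lf; last by rewrite !(dead _ lf).
by have := CX f; rewrite /sign_le (negbTE (h f lf)) => /eqP.
Qed.

(* [n] stands for the convex cell of the points x + iy with x in the face [re n]
   and y in the face [im n]; these cells stratify the complement. *)
Definition complexes : {set csv} :=
  [set n : csv | [&& re n \in L, im n \in L &
     [forall f, live f ==> (at_ n f != (s0, s0))]]]%SET.

Lemma complexesP n : reflect [/\ re n \in L, im n \in L & forall f,
  live f -> at_ n f != (s0, s0)]
  (n \in complexes).
Proof.
rewrite finset.in_set; apply: (iffP and3P) => -[h1 h2 h]; split => //.
  by move=> f; apply/implyP; move/forallP: h; apply.
by apply/forallP => f; apply/implyP; exact: h.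
Qed.

Lemma cvec_complexes X Y : X \in L -> Y \in L ->
  (forall f, live f -> (X f, Y f) != (s0, s0)) -> cvec (fun f => (X f, Y f)) \in complexes.
Proof.
by move=> XL YL h; apply/complexesP; rewrite re_cvec im_cvec; split => // f lf;
  rewrite at_cvec h.
Qed.

(** The imaginary part matters only where the real part vanishes: there it selects the tope adjacent
    to the face [re n]. *)
Definition to_salvetti n := (re n, compose (re n) (im n)).

Lemma salv_le_refl (p : signvec E * signvec E) : p \in salvetti L -> salv_le p p.
Proof. by rewrite finset.in_set /salv_le sv_le_refl => /and3P[_ _ ->]. Qed.

Lemma salv_le_trans (p q r : signvec E * signvec E) : salv_le p q -> salv_le q r -> salv_le p r.
Proof.
move=> /andP[h1 /eqP e1] /andP[h2 /eqP e2];
  rewrite /salv_le -e1 -e2 compose_absorb// eqxx andbT.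
exact: sv_le_trans h2 h1.
Qed.

Lemma to_salvetti_in n : n \in complexes -> to_salvetti n \in salvetti L.
Proof.
move=> /complexesP[rL iL h]; rewrite finset.in_set /to_salvetti /= rL compose_absorb
  ?sv_le_refl// eqxx andbT.
apply/topesP; split; first exact: L_compose.
move=> f /h; rewrite /at_ !ffunE xpair_eqE negb_and; by case: ifP => //= ->.
Qed.

Lemma to_salvetti_mono n m : n \in complexes -> m \in complexes -> sv_le n m ->
  salv_le (to_salvetti m) (to_salvetti n).
Proof.
move=> /complexesP[rn iL h] /complexesP[rm im_ h'] nm; rewrite /salv_le /= le_re//=.
rewrite compose_absorb ?le_re//; apply/eqP/ffunP => f; rewrite !ffunE.
case: eqP => // mf; case: (boolP (live f)) => lf; last first.
  by have := dead iL lf; have := dead im_ lf; rewrite !ffunE => -> ->.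
have /andP[/= h1 h2] := (at_leP _ _ nm) f.
move: h1 h2 (h f lf); rewrite /at_ mf xpair_eqE /sign_le orbb => /eqP -> /=.
by case: eqP => //= _ /eqP.
Qed.

(** One statement serves both identifications: [P] and [K] are trivial for all cells, and prescribe
    the entry (+, 0) at [e] for the deconed ones. The imaginary parts [Y] over [p] solve
    [compose p.1 Y = p.2]; they are closed under elimination, and the cells of the fibre with
    imaginary part below [Y] have the greatest element [(p.1, Y)]. *)
Lemma complexes_salvetti (P : pred (signvec E)) (K : E -> pred sign) (S' : {set signvec E *
  signvec E}) :
  S' \subset salvetti L ->
  (forall f, K f splus -> K f sminus -> K f s0) ->
  (forall n, n \in complexes -> P (re n) -> (forall f, K f (im n f)) -> to_salvetti n \in S') ->
  (forall p, p \in S' -> P p.1) ->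
  (forall p, p \in S' -> exists2 Y, Y \in L & (forall f, K f (Y f)) /\ compose p.1 Y = p.2) ->
  hequiv R (realization_set R [set n in complexes | P (re n) && [forall f,
    K f (im n f)]]%SET (@sv_le _))
           (realization_set R S' (@salv_le E)).
Proof.
move=> S'S K0 toS' S'P S'Y; set A := [set n in complexes | _]%SET.
have inA n : (n \in A) = [&& n \in complexes, P (re n) & [forall f, K f (im n f)]].
  exact: finset.in_set.
have Acomp n : n \in A -> n \in complexes by rewrite inA => /and3P[].
rewrite -(realization_flip R S').
apply: (quillen (phi := to_salvetti)).
- by move=> n; rewrite inA => /and3P[nN Pn /forallP Kn]; exact: toS'.
- by move=> n m /Acomp nN /Acomp mN; exact: to_salvetti_mono.
- by move=> p pS; apply: salv_le_refl; exact: (fintype.subsetP S'S).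
- by move=> p q r _ _ _ pq qr; exact: salv_le_trans qr pq.
move=> p pS; have [Y0 Y0L [KY0 Y0p]] := S'Y _ pS.
have := fintype.subsetP S'S _ pS; rewrite finset.in_set => /and3P[p1L /topesP[p2L p2live] _].
(* The equation [compose p.1 Y = p.2] constrains [Y] only at the zeros of [p.1]; elsewhere the
   solution [Y0] already witnesses it. *)
pose K' f s := K f s && ((p.1 f == s0) ==> (s == p.2 f)).
pose B := filter_coords L K'.
set Fb := [set n in A | _]%SET.
have inFb n : (n \in Fb) = (n \in A) && salv_le p (to_salvetti n) by exact: finset.in_set.
have BE Y : Y \in B <-> [/\ Y \in L, forall f, K f (Y f) & compose p.1 Y = p.2].
  split; first move=> /mem_filter_coords[YL h].
    split=> //; first by move=> f; have /andP[] := h f.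
    apply/ffunP => f; rewrite ffunE; have /andP[_] := h f.
    case: eqP => [_ /eqP //|pf _].
    move: Y0p => /ffunP /(_ f); rewrite ffunE.
    by case: eqP.
  move=> [YL KY Yp]; apply/mem_filter_coords; split => // f; rewrite /K' KY /=.
  by apply/implyP => pf; rewrite -Yp ffunE pf.
have Bctr : contractible R (realization_set R B (@sv_le E)).
  apply: (@elimination_closed_contractible _ R B Y0); last by apply/BE.
  apply: filter_coords_closed; first exact: OM_elimination_closed.
  move=> f /andP[k1 i1] /andP[k2 i2]; rewrite /K' K0//=.
  by apply/implyP => pf; move: i1 i2; rewrite pf /= => /eqP <-.
apply: contractible_hequiv Bctr; first exact: closed_realization.
apply: (quillen (phi := im)) => //.
- move=> n; rewrite inFb inA => /andP[/and3P[/complexesP[rL iL _] _ /forallP Kn]].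
  rewrite /salv_le => /andP[/= nr /eqP nc]; apply/BE; split => //.
  by rewrite -nc compose_absorb.
- by move=> n m _ _; exact: le_im.
- by move=> Y _; exact: sv_le_refl.
- by move=> X Y Z _ _ _; exact: sv_le_trans.
move=> Y /BE[YL KY Yp]; pose m := cvec (fun f => (p.1 f, Y f)).
have mre : re m = p.1 by exact: re_cvec.
have mim : im m = Y by exact: im_cvec.
have mFb : m \in Fb.
  rewrite inFb inA /salv_le /to_salvetti /= mre mim S'P// sv_le_refl /= compose_absorb
    ?sv_le_refl//.
  rewrite Yp eqxx andbT; apply/andP; split; last by apply/forallP.
  apply: cvec_complexes => // f lf; have := p2live f lf; rewrite -Yp ffunE xpair_eqE negb_and.
  by case: ifP => //= ->.
apply: (@cone_contractible R _ _ _ m); first by rewrite finset.in_set mFb mim /= sv_le_refl.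
  exact: sv_le_refl.
move=> n; rewrite finset.in_set inFb => /andP[/andP[nA /andP[/= nr _]] ni].
apply/orP; left; apply/at_leP => f; rewrite at_cvec /le2 /=.
move/sv_leP: nr => /(_ f); move/sv_leP: ni => /(_ f).
by rewrite /re !ffunE => -> ->.
Qed.

Lemma hequiv_complexes : hequiv R (realization_set R complexes (@sv_le _))
  (realization_set R (salvetti L) (@salv_le E)).
Proof.
have := @complexes_salvetti predT (fun=> predT) (salvetti L).
have -> : [set n in complexes | predT (re n) && [forall f : E, predT (im n f)]]%SET = complexes.
  by apply/setP => n; rewrite finset.in_set; case: (n \in complexes) => //=; apply/forallP.
apply => //; first by move=> n nN _ _; exact: to_salvetti_in.
move=> p; rewrite finset.in_set => /and3P[_ /topesP[p2L _] /eqP pp].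
by exists p.2.
Qed.

Definition positives : {set csv} :=
  [set n in complexes | at_ n e == (splus, s0)]%SET.

Lemma hequiv_positives : hequiv R (realization_set R positives (@sv_le _))
  (realization_set R (dsalvetti L e) (@salv_le E)).
Proof.
pose K f : pred sign := fun s => (f == e) ==> (s == s0).
have -> : positives = [set n in complexes | (re n e == splus) && [forall f, K f (im n f)]]%SET.
  apply/setP => n; rewrite [LHS]finset.in_set [RHS]finset.in_set; congr andb.
  rewrite /at_ xpair_eqE [re n e]ffunE; congr andb; apply/idP/forallP.
    by move=> h f; apply/implyP => /eqP ->; rewrite ffunE.
  by move=> /(_ e); rewrite /K eqxx ffunE.
apply: (@complexes_salvetti (fun X => X e == splus) K).
- by apply/fintype.subsetP => p; rewrite finset.in_set => /andP[].
- by move=> f; rewrite /K; case: (f == e).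
- move=> n nN /eqP ne _; rewrite finset.in_set to_salvetti_in//=.
  have /complexesP[rL iL _] := nN.
  by rewrite 2!finset.in_set /to_salvetti /= rL L_compose//= [compose _ _ e]ffunE ne !eqxx.
- by move=> p; rewrite !finset.in_set => /and3P[_ /andP[_ ->]].
move=> p; rewrite !finset.in_set =>
  /andP[/and3P[p1L /andP[p2L _] /eqP pp] /andP[/andP[_ /eqP p1e] /andP[_ /eqP p2e]]].
have [_ _ _ elim] := OM.
(* Eliminate [e] between the tope and the negative of the face. At zeros of the face nothing is
   separated, so the result agrees there with the tope, and it vanishes at [e]. *)
have sp : sep p.2 (sv_neg p.1) e by rewrite /sep ffunE p1e p2e.
have [Y YL [Ye Yf]] := elim _ _ _ p2L (L_neg p1L) sp; exists Y => //; split.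
  by move=> f; apply/implyP => /eqP ->; rewrite Ye.
rewrite -[RHS]pp; apply/ffunP => f; rewrite !ffunE; case: eqP => // p1f.
rewrite Yf ?ffunE; first by rewrite p1f; case: eqP.
by rewrite /sep ffunE p1f; case: (p.2 f) => [[]|].
Qed.

(** * Dividing by the coordinate at [e] *)

Definition arcs : {set sign * sign} := [set a | a != (s0, s0)]%SET.

Definition over_arcs : {set (sign * sign) * csv} :=
  [set z | [&& z.1 \in arcs, z.2 \in complexes & le2 (at_ z.2 e) z.1]]%SET.

(* [((a, n), n')]: dividing the points of [n] by their [e]-coordinate, whose
   argument is in the arc [a], may lead to [n']. *)
Definition rotations : {set ((sign * sign) * csv) * csv} :=
  [set z | [&& z.1 \in over_arcs, z.2 \in positives &
     [forall f, swept z.1.1 (at_ z.1.2 f) (at_ z.2 f)]]]%SET.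

Local Notation sv_ge := (fun n m : csv => sv_le m n).
Local Notation arc_le := (prod_le le2 (@sv_le (E + E)%type)).

Lemma in_arcs a : (a \in arcs) = (a != (s0, s0)).
Proof. exact: finset.in_set. Qed.

Lemma over_arcsP a n :
  reflect [/\ a \in arcs, n \in complexes & le2 (at_ n e) a] ((a, n) \in over_arcs).
Proof. by rewrite [X in reflect _ X]finset.in_set; exact: and3P. Qed.

Lemma rotationsP a n n' : reflect [/\ (a, n) \in over_arcs, n' \in positives &
    forall f, swept a (at_ n f) (at_ n' f)] ((a, n, n') \in rotations).
Proof.
by rewrite [X in reflect _ X]finset.in_set; apply: (iffP and3P) => -[h1 h2 h3];
  split => //; apply/forallP.
Qed.

Lemma positivesP n : reflect (n \in complexes /\ at_ n e = (splus, s0)) (n \in positives).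
Proof.
by rewrite [X in reflect _ X]finset.in_set; apply: (iffP andP) => -[h1 h2]; split => //;
  apply/eqP.
Qed.

Lemma arc_le_trans z w v : arc_le z w -> arc_le w v -> arc_le z v.
Proof.
move=> /andP[h1 h2] /andP[h3 h4]; apply/andP; split; first exact: le2_trans h3.
exact: sv_le_trans h4.
Qed.

Lemma arc_le_refl z : arc_le z z.
Proof. by rewrite /prod_le le2_refl sv_le_refl. Qed.

Lemma at_e_neq0 n : n \in complexes -> at_ n e != (s0, s0).
Proof. by move=> /complexesP[_ _]; apply; exact: live_e. Qed.

(** The entry of [n] at [e] is nonzero, hence itself an arc, and it is the least arc whose closure
    contains it; each fibre thus has a least element. *)
Lemma hequiv_over_arcs : hequiv R (realization_set R over_arcs arc_le)
  (realization_set R complexes (@sv_le _)).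
Proof.
apply: (quillen_up (phi := snd)).
- by move=> [a n] /over_arcsP[].
- by move=> [a n] [b m] _ _ /andP[].
- by move=> n _; exact: sv_le_refl.
- by move=> n m l _ _ _; exact: sv_le_trans.
move=> n nN; apply: (@cone_contractible R _ _ _ (at_ n e, n)); last 1 first.
- move=> [b m]; rewrite finset.in_set => /andP[/over_arcsP[_ mN me] /= nm]; apply/orP; right.
  by rewrite /prod_le /= nm andbT; apply: le2_trans me; exact: (at_leP _ _ nm).
- rewrite finset.in_set sv_le_refl andbT; apply/over_arcsP; split => //; last exact: le2_refl.
  by rewrite in_arcs at_e_neq0.
- exact: arc_le_refl.
Qed.

Definition turnv a n := cvec (fun f => turn a (at_ n f)).
Definition unturnv a n := cvec (fun f => unturn a (at_ n f)).

(** Multiplication by a power of i permutes the real and imaginary parts up to sign, and [L] is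
    closed under negation. *)
Lemma turnv_complexes a n : n \in complexes -> turnv a n \in complexes.
Proof.
move=> /complexesP[rL iL h]; have := L_neg rL; have := L_neg iL => niL nrL.
suff [r i] : re (turnv a n) \in L /\ im (turnv a n) \in L.
  by apply/complexesP; split => // f lf; rewrite at_cvec turn_eq0 h.
have rE : re (turnv a n) = [ffun f => (turn a (re n f, im n f)).1].
  by apply/ffunP => f; rewrite !ffunE.
have iE : im (turnv a n) = [ffun f => (turn a (re n f, im n f)).2].
  by apply/ffunP => f; rewrite !ffunE.
suff H (X : signvec E) : X = re n \/ X = im n \/ X = sv_neg (re n) \/ X = sv_neg (im n) ->
  X \in L.
  rewrite rE iE; split; apply: H; clear;
  by case: a => [[[]|] [[]|]];
    (do [left; by apply/ffunP => f; rewrite !ffunE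
       |right; left; by apply/ffunP => f; rewrite !ffunE
       |right; right; left; by apply/ffunP => f; rewrite !ffunE
       |right; right; right; by apply/ffunP => f; rewrite !ffunE]).
by case=> [->|[->|[->|->]]].
Qed.

Lemma unturnvK a : cancel (unturnv a) (turnv a).
Proof. by move=> n; apply: at_inj => f; rewrite !at_cvec unturnK. Qed.

Lemma turnvK a : cancel (turnv a) (unturnv a).
Proof. by move=> n; apply: at_inj => f; rewrite !at_cvec turnK. Qed.

Lemma unturnv_complexes a n : n \in complexes -> unturnv a n \in complexes.
Proof.
have [b ab] : exists b, unturn a =1 turn b.
  case: a => [[[]|] [[]|]]; do [by exists (splus, s0)|by exists (s0, splus)
    |by exists (sminus, s0)|by exists (s0, sminus)].
move=> nN; have -> : unturnv a n = turnv b n by apply: at_inj => f; rewrite !at_cvec.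
exact: turnv_complexes.
Qed.

Lemma unturnv_mono a n m : sv_le n m -> sv_le (unturnv a n) (unturnv a m).
Proof. by move=> /at_leP h; apply/at_leP => f; rewrite !at_cvec unturn_mono. Qed.

Lemma turnv_mono a n m : sv_le n m -> sv_le (turnv a n) (turnv a m).
Proof. by move=> /at_leP h; apply/at_leP => f; rewrite !at_cvec turn_mono. Qed.

Definition targets a n : {set csv} :=
  [set n' in positives | [forall f, swept a (at_ n f) (at_ n' f)]]%SET.

Definition sources a n' : {set csv} :=
  [set n in complexes | le2 (at_ n e) a && [forall f, swept a (at_ n f) (at_ n' f)]]%SET.

Lemma targetsP a n n' : reflect (n' \in positives /\ forall f, swept a (at_ n f) (at_ n' f))
  (n' \in targets a n).
Proof. by rewrite [X in reflect _ X]finset.in_set; apply: (iffP andP) => -[? ?];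
  split => //; apply/forallP. Qed.

Lemma sourcesP a n n' : reflect [/\ n \in complexes, le2 (at_ n e) a &
  forall f, swept a (at_ n f) (at_ n' f)] (n \in sources a n').
Proof. by rewrite [X in reflect _ X]finset.in_set; apply: (iffP and3P) => -[? ? ?];
  split => //; apply/forallP. Qed.

(** On a ray the targets are the faces of the rotated cell that lie in [positives], with the rotated
    cell as the greatest. *)
Lemma targets_ray a n : (a, n) \in over_arcs -> ~~ quadrant a ->
  contractible R (realization_set R (targets a n) (@sv_le _)).
Proof.
move=> /over_arcsP[aA nN na] qa.
apply: (@cone_contractible R _ _ _ (unturnv a n)); last 1 first.
- move=> n' /targetsP[_ h]; apply/orP; left; apply/at_leP => f.
  by have := h f; rewrite /swept (negbTE qa) at_cvec.
- apply/targetsP; split.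
    apply/positivesP; split; first exact: unturnv_complexes.
    by rewrite at_cvec unturn_ray// at_e_neq0.
  by move=> f; rewrite /swept (negbTE qa) at_cvec le2_refl.
- exact: sv_le_refl.
Qed.

Lemma sources_ray a n' : a \in arcs -> n' \in positives -> ~~ quadrant a ->
  contractible R (realization_set R (sources a n') (@sv_le _)).
Proof.
rewrite in_arcs => aA /positivesP[nN ne] qa.
apply: (@cone_contractible R _ _ _ (turnv a n')); last 1 first.
- move=> n /sourcesP[_ _ h]; apply/orP; right; rewrite -(unturnvK a n); apply: turnv_mono.
  by apply/at_leP => f; have := h f; rewrite /swept (negbTE qa) at_cvec.
- apply/sourcesP; split; first exact: turnv_complexes.
    by rewrite at_cvec ne turn_ray// le2_refl.
  by move=> f; rewrite /swept (negbTE qa) at_cvec turnK le2_refl.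
- exact: sv_le_refl.
Qed.

(** A fibre consists of triples over smaller arcs and cells. By monotonicity of [swept], their last
    components are targets of [(a, n)] itself, and the triples over each target have a greatest
    element; so the fibre is equivalent to [targets a n]. *)
Lemma hequiv_rotations_over :
  (forall a n, (a, n) \in over_arcs -> contractible R (realization_set R (targets a n)
    (@sv_le _))) ->
  hequiv R (realization_set R rotations (prod_le arc_le sv_ge)) (realization_set R
    over_arcs arc_le).
Proof.
move=> tctr; apply: (quillen (phi := fst)).
- by move=> [[a n] n'] /rotationsP[].
- by move=> z w _ _ /andP[].
- by move=> z _; exact: arc_le_refl.
- by move=> z w v _ _ _; exact: arc_le_trans.
move=> [a n] anM; have := tctr a n anM; rewrite -realization_flip.
apply: contractible_hequiv; first exact: closed_realization.
have [aA nN na] := over_arcsP _ _ anM.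
apply: (quillen (phi := snd)).
- move=> [[b m] n']; rewrite finset.in_set => /andP[/rotationsP[bm n'P sw] /andP[/= ba mn]].
  apply/targetsP; split => // f; have := sw f; have /over_arcsP[] := bm;
    rewrite in_arcs => b0 _ _.
  move/(swept_arc b0 ba); apply: swept_mono; last exact: le2_refl.
  exact: (at_leP _ _ mn).
- by move=> z w _ _ /andP[].
- by move=> n' _; exact: sv_le_refl.
- by move=> l m k _ _ _ lm mk; exact: sv_le_trans mk lm.
move=> n' /targetsP[n'P sw].
apply: (@cone_contractible R _ _ _ (a, n, n')); last 1 first.
- move=> [[b m] m']; rewrite !finset.in_set => /andP[/andP[_ /= h1] h2].
  by apply/orP; left; apply/andP.
- rewrite finset.in_set /= sv_le_refl andbT finset.in_set arc_le_refl andbT.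
  by apply/rotationsP.
- by apply/andP; split; [exact: arc_le_refl|exact: sv_le_refl].
Qed.

Lemma hequiv_rotations_prod :
  (forall a n', a \in arcs -> n' \in positives ->
     contractible R (realization_set R (sources a n') (@sv_le _))) ->
  hequiv R (realization_set R rotations (prod_le arc_le sv_ge))
    (realization_set R (finset.setX arcs positives) (prod_le le2 sv_ge)).
Proof.
move=> sctr; apply: (quillen (phi := fun z => (z.1.1, z.2))).
- move=> [[a n] n'] /rotationsP[/over_arcsP[aA _ _] n'P _].
  by rewrite finset.in_setX aA n'P.
- by move=> z w _ _ /andP[/andP[h1 _] h2]; apply/andP.
- by move=> z _; rewrite /prod_le le2_refl sv_le_refl.
- move=> z w v _ _ _ /andP[h1 h2] /andP[h3 h4]; apply/andP; split; first exact: le2_trans h3.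
  exact: sv_le_trans h4 h2.
move=> [a n']; rewrite finset.in_setX => /andP[/= aA n'P].
have := sctr a n' aA n'P.
apply: contractible_hequiv; first exact: closed_realization.
apply: (quillen (phi := fun z => z.1.2)).
- move=> [[b m] m']; rewrite finset.in_set => /andP[/rotationsP[bm m'P sw] /andP[/= ba nm]].
  have /over_arcsP[] := bm; rewrite in_arcs => b0 mN mb.
  apply/sourcesP; split => //; first exact: le2_trans ba.
  move=> f; have := sw f; move/(swept_arc b0 ba); apply: swept_mono; first exact: le2_refl.
  exact: (at_leP _ _ nm).
- by move=> z w _ _ /andP[/andP[]].
- by move=> n _; exact: sv_le_refl.
- by move=> l m k _ _ _; exact: sv_le_trans.
move=> m /sourcesP[mN ma sw].
apply: (@cone_contractible R _ _ _ (a, m, n')); last 1 first.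
- move=> [[b k] k']; rewrite !finset.in_set => /andP[/andP[_ /andP[/= h1 h2]] h3].
  by apply/orP; left; apply/andP; split => //; apply/andP.
- rewrite finset.in_set /= sv_le_refl andbT finset.in_set; apply/andP; split; last first.
    by rewrite /prod_le /= le2_refl sv_le_refl.
  by apply/rotationsP; split => //; apply/over_arcsP.
- by apply/andP; split; [exact: arc_le_refl|exact: sv_le_refl].
Qed.

(** * Contractible fibres over quadrants *)

Definition pairset (K : E -> pred (sign * sign)) : {set csv} :=
  [set n : csv | [&& re n \in L, im n \in L & [forall f, K f (at_ n f)]]]%SET.

Lemma pairsetP (K : E -> pred (sign * sign)) n : reflect [/\ re n \in L,
  im n \in L & forall f, K f (at_ n f)] (n \in pairset K).
Proof.
by rewrite finset.in_set; apply: (iffP and3P) => -[? ? h]; split => //; apply/forallP.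
Qed.

Lemma re_compose n m : re (compose n m) = compose (re n) (re m).
Proof. by apply/ffunP => f; rewrite !ffunE. Qed.

Lemma im_compose n m : im (compose n m) = compose (im n) (im m).
Proof. by apply/ffunP => f; rewrite !ffunE. Qed.

Lemma at_compose n m f : at_ (compose n m) f = compose2 (at_ n f) (at_ m f).
Proof. by rewrite /at_ !ffunE. Qed.

(** Eliminate in the part, real or imaginary, that contains the coordinate and compose in the other.
    Separated coordinates of the first part may take any sign, which [pair_stable] tolerates. *)
Lemma pairset_closed (K : E -> pred (sign * sign)) : (forall f,
  pair_stable (K f)) -> elimination_closed (pairset K).
Proof.
have [Lc Le] := OM_elimination_closed; move=> Kst; split.
  move=> n m /pairsetP[rn i_n Kn] /pairsetP[rm i_m Km]; apply/pairsetP.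
  rewrite re_compose im_compose; split; [exact: Lc|exact: Lc|move=> f].
  by apply: (Kst f) (Kn f) (Km f) _ _ => _; rewrite at_compose.
move=> n m [g|g] /pairsetP[rn i_n Kn] /pairsetP[rm i_m Km] snm.
- have s' : sep (re n) (re m) g by rewrite /sep !ffunE.
  have [Z ZL [Zg Zf]] := Le _ _ _ rn rm s'.
  exists (cvec (fun f => (Z f, compose (im n) (im m) f))).
    apply/pairsetP; rewrite re_cvec im_cvec; split => //; first exact: Lc.
    move=> f; rewrite at_cvec; apply: (Kst f) (Kn f) (Km f) _ _ => /= [h|_];
      last by rewrite !ffunE.
    by rewrite Zf ?ffunE// /sep !ffunE negb_and negbK.
  split; first by rewrite ffunE /= Zg.
  move=> [f|f] sf; rewrite ffunE /=; last by rewrite !ffunE.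
  by rewrite Zf ?ffunE//; move: sf; rewrite /sep !ffunE.
- have s' : sep (im n) (im m) g by rewrite /sep !ffunE.
  have [Z ZL [Zg Zf]] := Le _ _ _ i_n i_m s'.
  exists (cvec (fun f => (compose (re n) (re m) f, Z f))).
    apply/pairsetP; rewrite re_cvec im_cvec; split => //; first exact: Lc.
    move=> f; rewrite at_cvec; apply: (Kst f) (Kn f) (Km f) _ _ => /= [_|h];
      first by rewrite !ffunE.
    by rewrite Zf ?ffunE// /sep !ffunE negb_and negbK.
  split; first by rewrite ffunE /= Zg.
  move=> [f|f] sf; rewrite ffunE /=; first by rewrite !ffunE.
  by rewrite Zf ?ffunE//; move: sf; rewrite /sep !ffunE.
Qed.

(* The real part of z / z_e is generic in [re n o im n]; elimination at [e] gives
   its imaginary part. *)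
Lemma open_sector_base n : n \in complexes -> le2 (at_ n e) (splus, splus) ->
  exists2 n', n' \in positives & forall f, open_sector (at_ n f) (at_ n' f).
Proof.
move=> nN ne; have [rL iL h] := complexesP _ nN.
pose P := compose (re n) (im n).
have PL : P \in L by exact: L_compose.
suff [Q QL [Qe Qf]] : exists2 Q, Q \in L & Q e = s0 /\ forall f,
    [&& open_sector (at_ n f) (P f, Q f) & (at_ n f != (s0, s0)) ==> ((P f, Q f) != (s0, s0))].
  exists (cvec (fun f => (P f, Q f))); last by move=> f; rewrite at_cvec; have /andP[] := Qf f.
  apply/positivesP; split.
    apply: cvec_complexes => // f lf; have /andP[_ /implyP] := Qf f; apply; exact: h.
  rewrite at_cvec Qe /P !ffunE; move: ne (at_e_neq0 nN); rewrite /at_.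
  by case: (n (inl e)) => [[]|]; case: (n (inr e)) => [[]|].
(* If z_e is positive real or positive imaginary, the imaginary part of z / z_e has the signs of
   [im n] or of the negative of [re n], and there is nothing to eliminate. *)
case: (n (inr e) =P s0) => [ie|/eqP ie].
  exists (im n) => //; split; first by rewrite ffunE.
  move=> f; rewrite /P /at_ !ffunE.
  by case: (n (inl f)) => [[]|]; case: (n (inr f)) => [[]|].
case: (n (inl e) =P s0) => [re_|/eqP re_].
  exists (sv_neg (re n)); first exact: L_neg.
  split; first by rewrite !ffunE re_.
  move=> f; rewrite /P /at_ !ffunE.
  by case: (n (inl f)) => [[]|]; case: (n (inr f)) => [[]|].
have [_ _ _ elim] := OM.
have s' : sep (im n) (sv_neg (re n)) e.
  rewrite /sep !ffunE; move: ne ie re_; rewrite /at_.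
  by case: (n (inl e)) => [[]|]; case: (n (inr e)) => [[]|].
have [Q QL [Qe Qf]] := elim _ _ _ iL (L_neg rL) s'; exists Q => //; split => // f.
move: (Qf f); rewrite /P /at_ /sep !ffunE.
by case: (n (inl f)) => [[]|]; case: (n (inr f)) => [[]|] /=; try (by move=> /(_ isT) ->);
  move=> _; case: (Q f) => [[]|].
Qed.

(** Once the quadrant is turned to the first one, the targets in open sectors form a set closed
    under elimination. Its inclusion into all targets is an equivalence: the members above a target
    [n'] form again such a set, and composing [n'] with the base point [n0] gives one of them. *)
Lemma targets_quadrant a n : (a, n) \in over_arcs -> quadrant a ->
  contractible R (realization_set R (targets a n) (@sv_le _)).
Proof.
move=> /over_arcsP[aA nN na] qa; pose u := unturnv a n.
have uN : u \in complexes by exact: unturnv_complexes.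
have ue : le2 (at_ u e) (splus, splus) by rewrite at_cvec -unturn_quadrant.
have [n0 n0P n0u] := open_sector_base uN ue.
have [n0N n0e] := positivesP _ n0P.
have [_ _ ulive] := complexesP _ uN.
pose K f p := (open_sector (at_ u f) p && (live f ==> (p != (s0, s0)))) &&
   ((f == e) ==> (p == (splus, s0))).
have Kst f : pair_stable (K f).
  apply: pair_stableI; first by apply: pair_stable_open_sector => lf; exact: ulive.
  by case: (f == e) => //=; exact: pair_stable_eq.
have sweptE f p : swept a (at_ n f) p = sector (at_ u f) p by rewrite /swept qa at_cvec.
have KE n' : (n' \in pairset K) = (n' \in positives) && [forall f,
  open_sector (at_ u f) (at_ n' f)].
  apply/pairsetP/andP => [[rL iL Kn]|[/positivesP[/complexesP[rL iL h] n'e] /forallP ho]].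
    split; last by apply/forallP => f; have /andP[/andP[]] := Kn f.
    apply/positivesP; split; last by have /andP[_] := Kn e; rewrite eqxx => /eqP.
    apply/complexesP; split => // f lf; have /andP[/andP[_]] := Kn f.
    by rewrite lf.
  split => // f; rewrite /K ho /=; apply/andP; split; first by apply/implyP; exact: h.
  by apply/implyP => /eqP ->; rewrite n'e.
have Ksub n' : n' \in pairset K -> n' \in targets a n.
  rewrite KE => /andP[n'P /forallP h]; apply/targetsP; split => // f.
  by rewrite sweptE; have /and3P[] := h f.
have KstI n' f : pair_stable (fun p => K f p && le2 (at_ n' f) p).
  by apply: pair_stableI => //; exact: pair_stable_ge.
have n0K : n0 \in pairset K by rewrite KE n0P; apply/forallP.
have c0 := elimination_closed_contractible R (pairset_closed Kst) n0K.
apply: contractible_hequiv c0; first exact: closed_realization.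
apply: hequiv_sym; apply: (quillen_up (phi := id)) => //.
- by move=> n' _; exact: sv_le_refl.
- by move=> l m k _ _ _; exact: sv_le_trans.
move=> n' /targetsP[n'P sw]; have [n'N n'e] := positivesP _ n'P.
have -> : [set p in pairset K | sv_le n' p]%SET = pairset (fun f p =>
  K f p && le2 (at_ n' f) p).
  apply/setP => m; rewrite [LHS]finset.in_set; apply/andP/pairsetP.
    by move=> [/pairsetP[h1 h2 h3] /at_leP h4]; split => // f; rewrite h3 h4.
  move=> [h1 h2 h3]; split; last by apply/at_leP => f; have /andP[] := h3 f.
  by apply/pairsetP; split => // f; have /andP[] := h3 f.
apply: (@elimination_closed_contractible _ R _ (compose n' n0)).
  by apply: pairset_closed => f; exact: KstI.
have [r0 i0 l0] := complexesP _ n0N; have [r' i' l'] := complexesP _ n'N.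
apply/pairsetP; rewrite re_compose im_compose; split;
  [exact: L_compose|exact: L_compose|move=> f].
rewrite at_compose; apply/andP; split; last by rewrite -at_compose; apply/at_leP/sv_le_composel.
apply/andP; split; last by apply/implyP => /eqP ->; rewrite n'e n0e.
apply/andP; split; first by apply: open_sector_compose => //; rewrite -sweptE.
apply/implyP => lf; have := l' f lf; rewrite /compose2;
  by case: (at_ n' f) => [[[]|] [[]|]]; case: (at_ n0 f) => [[[]|] [[]|]].
Qed.

Lemma sources_quadrant a n' : a \in arcs -> n' \in positives -> quadrant a ->
  contractible R (realization_set R (sources a n') (@sv_le _)).
Proof.
move=> aA /positivesP[nN ne] qa; have [rL iL nlive] := complexesP _ nN.
pose A f := sector_re (at_ n' f); pose B f := sector_im (at_ n' f).
(* Where the entries of [n'] are nonzero and opposite, no sign satisfies the second alternative [B],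
   so the real part must satisfy [A]. Elsewhere a suitable imaginary part can still be found. *)
pose KX f (x : sign) := ((f == e) ==> sign_le x splus) &&
  (((at_ n' f).1 != s0) && ((at_ n' f).2 == sneg (at_ n' f).1) ==> A f x).
pose KY X f (y : sign) := ((f == e) ==> sign_le y splus) && (~~ A f (X f) ==> B f y).
pose LX := filter_coords L KX; pose LY X := filter_coords L (KY X).
have sweptE f q : swept a q (at_ n' f) = A f (unturn a q).1 || B f (unturn a q).2.
  by rewrite /swept qa.
have KX0 f : KX f splus -> KX f sminus -> KX f s0.
  rewrite /KX /A /sector_re /at_; case: (f == e) => //=;
  by case: (n' (inl f)) => [[]|]; case: (n' (inr f)) => [[]|].
have KY0 X f : KY X f splus -> KY X f sminus -> KY X f s0.
  rewrite /KY /B /sector_im /at_; case: (f == e) => //=; case: (A f (X f)) => //=;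
  by case: (n' (inl f)) => [[]|]; case: (n' (inr f)) => [[]|].
(* The base points are the signs of x - y and x + y with y infinitesimal, the forms behind
   [sector_re] and [sector_im]. *)
have PX : compose (re n') (sv_neg (im n')) \in LX.
  apply/mem_filter_coords; split; first by apply: L_compose => //; exact: L_neg.
  move=> f; rewrite /KX /A /sector_re !ffunE; apply/andP; split.
    by apply/implyP => /eqP ->; move: ne; rewrite /at_ => -[-> ->].
  by rewrite /at_; case: (n' (inl f)) => [[]|]; case: (n' (inr f)) => [[]|].
have QY X : X \in LX -> compose (re n') (im n') \in LY X.
  move=> /mem_filter_coords[XL KXf]; apply/mem_filter_coords; split; first exact: L_compose.
  move=> f; rewrite /KY /B /sector_im; apply/andP; split.
    by apply/implyP => /eqP ->; move: ne; rewrite /at_ !ffunE => -[-> ->].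
  have /andP[_] := KXf f; case: (A f (X f)) => //; rewrite implybF !ffunE /at_.
  by case: (n' (inl f)) => [[]|]; case: (n' (inr f)) => [[]|].
have cX := elimination_closed_contractible R (filter_coords_closed OM_elimination_closed
  KX0) PX.
have cY X (XX : X \in LX) := elimination_closed_contractible R
  (filter_coords_closed OM_elimination_closed (KY0 X)) (QY X XX).
apply: contractible_hequiv cX; first exact: closed_realization.
apply: (quillen (phi := fun m => re (unturnv a m))).
- move=> m /sourcesP[mN me sw]; apply/mem_filter_coords.
  have [rm _ _] := complexesP _ (unturnv_complexes a mN); split => // f.
  have -> : re (unturnv a m) f = (unturn a (at_ m f)).1 by rewrite !ffunE.
  rewrite /KX; apply/andP; split.
    by apply/implyP => /eqP ->; move: me; rewrite unturn_quadrant// => /andP[].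
  apply/implyP => h; have := sw f; rewrite sweptE => /orP[//|].
  move: h; rewrite /B /sector_im; case: (at_ n' f) => x y /=;
    case: (unturn a (at_ m f)).2 => [[]|];
  by case: x => [[]|]; case: y => [[]|].
- by move=> m k _ _ mk; exact/le_re/unturnv_mono.
- by move=> X _; exact: sv_le_refl.
- by move=> X Y Z _ _ _; exact: sv_le_trans.
move=> X XX; apply: contractible_hequiv (cY X XX); first exact: closed_realization.
have /mem_filter_coords[XL KXf] := XX.
apply: (quillen (phi := fun m => im (unturnv a m))).
- move=> m; rewrite finset.in_set => /andP[/sourcesP[mN me sw] /sv_leP mX].
  have [_ i_m _] := complexesP _ (unturnv_complexes a mN).
  apply/mem_filter_coords; split => // f.
  have -> : im (unturnv a m) f = (unturn a (at_ m f)).2 by rewrite !ffunE.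
  rewrite /KY; apply/andP; split.
    by apply/implyP => /eqP ->; move: me; rewrite unturn_quadrant// => /andP[].
  (* [A] is increasing, so its failure at [X] persists at smaller real parts, and the second
     alternative must hold. *)
  apply/implyP => nA; have := sw f; rewrite sweptE => /orP[h|//].
  case/negP: nA; apply: sector_re_mono h; first exact: le2_refl.
  by have := mX f; rewrite !ffunE.
- by move=> m k _ _ mk; exact/le_im/unturnv_mono.
- by move=> Y _; exact: sv_le_refl.
- by move=> Y Y' Z _ _ _; exact: sv_le_trans.
move=> Y /mem_filter_coords[YL KYf].
pose v := cvec (fun f => (X f, Y f)); pose m := turnv a v.
have um : unturnv a m = v by exact: turnvK.
have AB f : A f (X f) || B f (Y f).
  by have /andP[_] := KYf f; case: (A f (X f)).
have vN : v \in complexes.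
  apply: cvec_complexes => // f lf; have := AB f; have := nlive f lf.
  rewrite /A /B /sector_re /sector_im; case: (at_ n' f) => [[[]|] [[]|]] //= _;
  by case: (X f) => [[]|]; case: (Y f) => [[]|].
have atm f : unturn a (at_ m f) = (X f, Y f) by rewrite !at_cvec turnK.
have mF : m \in sources a n'.
  apply/sourcesP; split; first exact: turnv_complexes.
    rewrite unturn_quadrant// atm; have /andP[h1 _] := KXf e; have /andP[h2 _] := KYf e.
    by move: h1 h2; rewrite eqxx /= => h1 h2; apply/andP.
  by move=> f; rewrite sweptE atm.
apply: (@cone_contractible R _ _ _ m); last 1 first.
- move=> k; rewrite !finset.in_set => /andP[/andP[_ kX] kY].
  apply/orP; left; rewrite -(unturnvK a k); apply: turnv_mono; apply/at_leP => f.
  rewrite at_cvec at_cvec /le2 /=; move/sv_leP: kX => /(_ f); move/sv_leP: kY => /(_ f).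
  by rewrite !ffunE => -> ->.
- by rewrite finset.in_set um im_cvec sv_le_refl finset.in_set um re_cvec sv_le_refl mF.
- exact: sv_le_refl.
Qed.

End Matroid.

(** * The eight arcs form a circle *)

Section ArcsCircle.
Variable R : realType.

Lemma signs_contractible : contractible R (realization_set R [set: sign]%SET sign_le).
Proof.
apply: (@cone_contractible R _ _ _ s0); [exact: finset.in_setT|by []|]. 
by move=> x _; rewrite orbT.
Qed.

(** The open right and left half-circles and the two imaginary rays become the vertices of the
    4-cycle. A fibre is a single imaginary ray or a closed half-circle; the latter contracts through
    the sign of the imaginary part. *)
Lemma hequiv_arcs_square : hequiv R (realization_set R arcs le2)
  (realization_set R [set: bool * bool]%SET square_le).
Proof.
(* The default of [odflt] is reached only at (0, 0), which is not an arc. *)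
pose phi (a : sign * sign) : bool * bool :=
  if a.1 is Some s then (false, s) else (true, odflt true a.2).
rewrite -(realization_flip R [set: bool * bool]%SET).
apply: (quillen (phi := phi)).
- by move=> a _; exact: finset.in_setT.
- by move=> [[[]|] [[]|]] [[[]|] [[]|]]; rewrite !in_arcs.
- by move=> [[] []] _.
- by move=> [[] []] [[] []] [[] []].
move=> [[] s] _.
  apply: (@cone_contractible R _ _ _ (None, Some s)).
  - by rewrite finset.in_set in_arcs; case: s.
  - exact: le2_refl.
  by move=> a; rewrite finset.in_set in_arcs; case: s; case: a => [[[]|] [[]|]].
apply: contractible_hequiv signs_contractible; first exact: closed_realization.
apply: (quillen (phi := snd)).
- by move=> a _; exact: finset.in_setT.
- by move=> a b _ _ /andP[].
- by move=> x _; exact: sign_le_refl.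
- by move=> x y z _ _ _; exact: sign_le_trans.
move=> y _; apply: (@cone_contractible R _ _ _ (Some s, y)).
- by rewrite !finset.in_set; case: s; case: y => [[]|].
- exact: le2_refl.
by move=> a; rewrite !finset.in_set; case: s; case: y => [[]|]; case: a => [[[]|] [[]|]].
Qed.

Lemma hequiv_arcs_circle : hequiv R (realization_set R arcs le2) (circle R).
Proof.
apply: hequiv_trans hequiv_arcs_square (hequiv_square_circle R);
  first exact: closed_realization.
exact: closed_circle.
Qed.

Lemma poset_arcs : poset_on arcs le2.
Proof.
split => [a _|a b _ _|a b c _ _ _]; [exact: le2_refl|exact: le2_anti|exact: le2_trans].
Qed.

End ArcsCircle.

(** The second hypothesis says that [e] is not a loop. At a loop [dsalvetti L e] is empty, and so is
    the product, while [salvetti L] contains a cell. *)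
Theorem theorem4p9 (R : realType) (E : finType) (L : {set signvec E}) (e : E) :
  is_OM_covectors L ->
  (exists2 X, X \in L & X e != s0) ->
  homotopy_equivalent R
    (set_type (realization_set R (salvetti L) (@salv_le E)))
    (set_type (circle R) * set_type (realization_set R (dsalvetti L e) (@salv_le E)))%type.
Proof.
move=> OM eL.
apply: (hequiv_embeds (embeds_set_type _) (embeds_prod (embeds_set_type _) (embeds_set_type
  _))).
pose ge (n m : signvec (E + E)%type) := sv_le m n.
have cl (T : finType) (P : {set T}) (le : rel T) : closed (realization_set R P le).
  exact: closed_realization.
apply: (@hequiv_trans _ _ _ _ _ (realization_set R (finset.setX arcs (positives L e))
  (prod_le le2 ge))).
- exact: cl.
- apply: closed_setX; [exact: closed_circle|exact: cl].
- apply: (hequiv_trans _ _ (hequiv_sym (hequiv_complexes R OM))); [exact: cl|exact: cl|].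
  apply: (hequiv_trans _ _ (hequiv_sym (hequiv_over_arcs R eL))); [exact: cl|exact: cl|].
  have ctr1 a n : (a, n) \in over_arcs L e ->
      contractible R (realization_set R (targets L e a n) (@sv_le _)).
    by move=> an; case: (boolP (quadrant a)); [exact: targets_quadrant|exact: targets_ray].
  have ctr2 a n : a \in arcs -> n \in positives L e ->
      contractible R (realization_set R (sources L e a n) (@sv_le _)).
    by move=> aA nP; case: (boolP (quadrant a)); [exact: sources_quadrant|exact: sources_ray].
  apply: (hequiv_trans _ _ (hequiv_sym (hequiv_rotations_over ctr1))); [exact: cl|exact: cl|].
  exact: hequiv_rotations_prod ctr2.
have poset_pos : poset_on (positives L e) ge.
  split => [n _|n m _ _ h1 h2|n m k _ _ _ h1 h2].
  - exact: sv_le_refl.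
  - exact: sv_le_anti.
  - exact: sv_le_trans h2 h1.
apply: hequiv_trans (hequiv_realization_prod R poset_arcs poset_pos) _.
- exact: cl.
- apply: closed_setX; [exact: closed_circle|exact: cl].
apply: hequiv_prod; first exact: hequiv_arcs_circle.
by rewrite realization_flip; exact: hequiv_positives.
Qed.
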